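(* Let $-\infty\le\tau<\sigma\le\infty$ and let $I$ be one of $(\tau,\sigma)$, $(\tau,\sigma]$, $[\tau,\sigma)$, $[\tau,\sigma]$ (an endpoint is included only if finite). Let $n\in\mathbb{N}$, let $\alpha,\beta,\gamma:I\to\mathbb{C}$ be continuous with $\alpha(t)\ne0$ for all $t\in I$, let $\bm{f}:I\to\mathbb{C}^n$ be continuous, and suppose there is a solution $\rho\in C^1(I,\mathbb{C})$ of $\alpha(t)(\rho'+\rho^2)+\beta(t)\rho+\gamma(t)=0$ on $I$. Define, for $t\in I$ (whenever the integrals exist), \[ f_1(t)=\int_t^\sigma\frac{e^{\int_t^s\Re\left(\rho(\mu)+\frac{\beta(\mu)}{\alpha(\mu)}\right)d\mu}}{|\alpha(s)|}ds,\qquad f_2(t)=\int_t^\sigma e^{-\int_t^s\Re(\rho(\mu))d\mu}ds, \] \[ f_3(t)=\int_\tau^t e^{\int_s^t\Re(\rho(\mu))d\mu}ds,\qquad f_4(t)=\int_\tau^t\frac{e^{-\int_s^t\Re\left(\rho(\mu)+\frac{\beta(\mu)}{\alpha(\mu)}\right)d\mu}}{|\alpha(s)|}ds. \] Consider the equation $(\ast)$: $\alpha(t)\bm{x}''+\beta(t)\bm{x}'+\gamma(t)\bm{x}=\bm{f}(t)$ on $I$. Then: (i) If $f_1,f_2$ exist on $I$ and $\sup_I f_1<\infty$, $\sup_I f_2<\infty$, then $(\ast)$ is Ulam stable on $I$ with Ulam constant \[ L_1=\sup_{t\in I}\int_t^\sigma\left(\int_s^\sigma\frac{e^{\int_s^\mu\Re\left(\rho(\nu)+\frac{\beta(\nu)}{\alpha(\nu)}\right)d\nu}}{|\alpha(\mu)|}d\mu\right)e^{-\int_t^s\Re(\rho(\mu))d\mu}ds.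 \] (ii) If $f_1,f_3$ exist on $I$ and $\sup_I f_1<\infty$, $\sup_I f_3<\infty$, then $(\ast)$ is Ulam stable on $I$ with Ulam constant \[ L_2=\sup_{t\in I}\int_\tau^t\left(\int_s^\sigma\frac{e^{\int_s^\mu\Re\left(\rho(\nu)+\frac{\beta(\nu)}{\alpha(\nu)}\right)d\nu}}{|\alpha(\mu)|}d\mu\right)e^{\int_s^t\Re(\rho(\mu))d\mu}ds. \] (iii) If $f_3,f_4$ exist on $I$ and $\sup_I f_3<\infty$, $\sup_I f_4<\infty$, then $(\ast)$ is Ulam stable on $I$ with Ulam constant \[ L_3=\sup_{t\in I}\int_\tau^t\left(\int_\tau^s\frac{e^{-\int_\mu^s\Re\left(\rho(\nu)+\frac{\beta(\nu)}{\alpha(\nu)}\right)d\nu}}{|\alpha(\mu)|}d\mu\right)e^{\int_s^t\Re(\rho(\mu))d\mu}ds. \]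
   Context: $\|\cdot\|$ is a norm on $\mathbb{C}^n$. Ulam stability: the equation $\alpha(t)\bm{x}''+\beta(t)\bm{x}'+\gamma(t)\bm{x}=\bm{f}(t)$ is Ulam stable on $I$ if there exists a constant $L>0$ such that for every $\varepsilon>0$ and every $\bm{\xi}\in C^2(I,\mathbb{C}^n)$ with $\sup_{t\in I}\|\alpha(t)\bm{\xi}''(t)+\beta(t)\bm{\xi}'(t)+\gamma(t)\bm{\xi}(t)-\bm{f}(t)\|\le\varepsilon$, there exists a solution $\bm{x}\in C^2(I,\mathbb{C}^n)$ of the equation with $\sup_{t\in I}\|\bm{\xi}(t)-\bm{x}(t)\|\le L\varepsilon$; such an $L$ is called an Ulam constant for the equation on $I$. $\Re(z)$ denotes the real part of $z\in\mathbb{C}$. *)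

(* Defs.v *)
From Stdlib Require Import Reals.
From Stdlib Require Fin.
From Coquelicot Require Import Coquelicot.
Open Scope R_scope.

Definition Iset (tau sigma : Rbar) (btau bsigma : bool) (t : R) : Prop :=
  (Rbar_lt tau t \/ (btau = true /\ tau = Finite t)) /\
  (Rbar_lt t sigma \/ (bsigma = true /\ sigma = Finite t)).

(** Filters "u -> sigma from below" and "u -> tau from above", used for the
    (possibly improper) integrals  int_t^sigma  and  int_tau^t. *)
Definition to_sigma (sigma : Rbar) : (R -> Prop) -> Prop :=
  within (fun u => Rbar_lt u sigma) (Rbar_locally' sigma).
Definition to_tau (tau : Rbar) : (R -> Prop) -> Prop :=
  within (fun u => Rbar_lt tau u) (Rbar_locally' tau).

Definition vec (n : nat) := Fin.t n -> C.

Definition is_norm {n : nat} (N : vec n -> R) : Prop :=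
  (forall v, 0 <= N v) /\
  (forall v, N v = 0 <-> v = (fun _ => RtoC 0)) /\
  (forall (c : C) v, N (fun i => Cmult c (v i)) = Cmod c * N v) /\
  (forall v w, N (fun i => Cplus (v i) (w i)) <= N v + N w).

Definition ccont_on (I : R -> Prop) (g : R -> C) : Prop :=
  forall t, I t -> filterlim g (within I (locally t)) (locally (g t)).

Definition cderiv_on (I : R -> Prop) (g g' : R -> C) : Prop :=
  forall t, I t ->
    filterlim (fun s => Cmult (RtoC (/ (s - t))) (Cminus (g s) (g t)))
      (within (fun s => I s /\ s <> t) (locally t)) (locally (g' t)).

Definition vC2_on {n : nat} (I : R -> Prop) (x x1 x2 : R -> vec n) : Prop :=
  forall i : Fin.t n,
    cderiv_on I (fun t => x t i) (fun t => x1 t i) /\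
    cderiv_on I (fun t => x1 t i) (fun t => x2 t i) /\
    ccont_on I (fun t => x2 t i).

Definition ulam_constant {n : nat} (I : R -> Prop) (N : vec n -> R)
  (alpha beta gamma : R -> C) (f : R -> vec n) (L : R) : Prop :=
  0 < L /\
  forall eps : R, 0 < eps ->
  forall xi xi1 xi2 : R -> vec n, vC2_on I xi xi1 xi2 ->
  (forall t, I t ->
     N (fun i => Cminus (Cplus (Cplus (Cmult (alpha t) (xi2 t i))
                                      (Cmult (beta t) (xi1 t i)))
                               (Cmult (gamma t) (xi t i)))
                        (f t i)) <= eps) ->
  exists x x1 x2 : R -> vec n, vC2_on I x x1 x2 /\
    (forall t, I t -> forall i,
       Cplus (Cplus (Cmult (alpha t) (x2 t i)) (Cmult (beta t) (x1 t i)))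
             (Cmult (gamma t) (x t i)) = f t i) /\
    (forall t, I t -> N (fun i => Cminus (xi t i) (x t i)) <= L * eps).

Definition ulam_stable {n : nat} (I : R -> Prop) (N : vec n -> R)
  (alpha beta gamma : R -> C) (f : R -> vec n) : Prop :=
  exists L, ulam_constant I N alpha beta gamma f L.

Definition reRBA (rho alpha beta : R -> C) (mu : R) : R :=
  Re (Cplus (rho mu) (Cdiv (beta mu) (alpha mu))).
Definition reR (rho : R -> C) (mu : R) : R := Re (rho mu).

(** Integrands of f1, ..., f4 (t is the parameter, s the integration variable). *)
Definition g1 (rho alpha beta : R -> C) (t s : R) : R :=
  exp (RInt (reRBA rho alpha beta) t s) / Cmod (alpha s).
Definition g2 (rho : R -> C) (t s : R) : R :=
  exp (- RInt (reR rho) t s).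
Definition g3 (rho : R -> C) (t s : R) : R :=
  exp (RInt (reR rho) s t).
Definition g4 (rho alpha beta : R -> C) (t s : R) : R :=
  exp (- RInt (reRBA rho alpha beta) s t) / Cmod (alpha s).

(* Main.v *)
(* With [q = rho + beta/alpha], the Riccati equation for [rho] factorizes the operator: if
   [w' = p/alpha - q w] and [z' = rho z + w], then [alpha z'' + beta z' + gamma z = p].  For an
   approximate solution [xi] with residual [p], the function [x = xi - z] solves the equation
   exactly, so it suffices to find [z] with [N (z t) <= L eps].  Both first-order equations are
   solved by variation of constants, the free constant being chosen so that the solution is the
   improper integral from the endpoint at which the corresponding hypothesis provides
   convergence; taking norms inside the two integrals gives exactly [eps H(t)], with [H] the
   double integral whose supremum is [L].  The three cases differ only in the endpoint chosen
   for each of the two equations. *)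

Require Import Defs.
From Stdlib Require Import Reals.
From Stdlib Require Fin.
From Coquelicot Require Import Coquelicot.
From Stdlib Require Import Lra Lia FunctionalExtensionality Classical IndefiniteDescription.
Open Scope R_scope.

(** * Limits in R and C *)

(** The constant [L] has to come out exactly for an arbitrary norm [N], whereas estimates by
    coordinates lose a factor depending on [N]. Coordinates are therefore confined to qualitative
    statements (existence of vector limits, continuity of [N]), and every quantitative bound goes
    through the triangle inequality for [N] on Riemann sums, whose constant is 1. The integrating
    factors are complex exponentials, whose modulus is [exp] of a real part; this is why the weights
    contain real parts only.

    The hypotheses give convergence and bounds for two single integrals, not for the double integral
    [H]. Its inner integral [G] is bounded by a constant [M1], so [H] converges by comparison with
    the second single integral and is at most [M1 * M2], where [M2] bounds that integral: the
    supremum is finite. It is positive, as an Ulam constant must be, because both integrands are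
    positive in the interior of the interval.

    Differentiation happens on an open set containing [I], with the fundamental theorem of calculus
    in its two-sided form; one-sided derivatives at included endpoints are recovered by
    restriction. *)

Lemma filterlim_R_eps {T : Type} (F : (T -> Prop) -> Prop) {FF : Filter F}
  (f : T -> R) (l : R) :
  filterlim f F (locally l) <->
  (forall eps, 0 < eps -> F (fun x => Rabs (f x - l) < eps)).
Proof.
  split.
  - intros H eps He.
    apply (H (fun y => Rabs (y - l) < eps)).
    exists (mkposreal eps He). intros y Hy. exact Hy.
  - intros H P [eps HP].
    unfold filtermap.
    generalize (H eps (cond_pos eps)); apply filter_imp.
    intros x Hx. apply HP. exact Hx.
Qed.

Lemma filterlim_R_plus {T : Type} (F : (T -> Prop) -> Prop) {FF : Filter F}
  (f g : T -> R) (lf lg : R) :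
  filterlim f F (locally lf) -> filterlim g F (locally lg) ->
  filterlim (fun x => f x + g x) F (locally (lf + lg)).
Proof.
  intros Hf Hg. eapply filterlim_comp_2; [exact Hf | exact Hg |].
  apply (filterlim_plus (V := R_NormedModule) lf lg).
Qed.

Lemma filterlim_R_mult {T : Type} (F : (T -> Prop) -> Prop) {FF : Filter F}
  (f g : T -> R) (lf lg : R) :
  filterlim f F (locally lf) -> filterlim g F (locally lg) ->
  filterlim (fun x => f x * g x) F (locally (lf * lg)).
Proof.
  intros Hf Hg. eapply filterlim_comp_2; [exact Hf | exact Hg |].
  apply (filterlim_mult (K := R_AbsRing) lf lg).
Qed.

Lemma filterlim_R_scal {T : Type} (F : (T -> Prop) -> Prop) {FF : Filter F}
  (k : R) (f : T -> R) (l : R) :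
  filterlim f F (locally l) -> filterlim (fun x => k * f x) F (locally (k * l)).
Proof.
  intros Hf. apply (filterlim_R_mult F); [apply filterlim_const | exact Hf].
Qed.

Lemma filterlim_R_minus {T : Type} (F : (T -> Prop) -> Prop) {FF : Filter F}
  (f g : T -> R) (lf lg : R) :
  filterlim f F (locally lf) -> filterlim g F (locally lg) ->
  filterlim (fun x => f x - g x) F (locally (lf - lg)).
Proof.
  intros Hf Hg. apply (filterlim_R_plus F); [exact Hf |].
  eapply filterlim_comp; [exact Hg |].
  apply (filterlim_opp (V := R_NormedModule)).
Qed.

Lemma filterlim_R_inv {T : Type} (F : (T -> Prop) -> Prop) {FF : Filter F}
  (f : T -> R) (l : R) :
  l <> 0 -> filterlim f F (locally l) -> filterlim (fun x => / f x) F (locally (/ l)).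
Proof.
  intros Hl Hf. eapply filterlim_comp; [exact Hf |].
  apply (continuous_Rinv_comp (fun y : R => y) l); [apply continuous_id | exact Hl].
Qed.

Lemma filterlim_R_abs {T : Type} (F : (T -> Prop) -> Prop) {FF : Filter F}
  (f : T -> R) (l : R) :
  filterlim f F (locally l) -> filterlim (fun x => Rabs (f x)) F (locally (Rabs l)).
Proof.
  intros Hf. eapply filterlim_comp; [exact Hf |].
  apply (filterlim_norm (V := R_NormedModule)).
Qed.

Lemma filterlim_R_exp {T : Type} (F : (T -> Prop) -> Prop) {FF : Filter F}
  (f : T -> R) (l : R) :
  filterlim f F (locally l) -> filterlim (fun x => exp (f x)) F (locally (exp l)).
Proof.
  intros Hf. eapply filterlim_comp; [exact Hf |].
  apply (continuous_exp_comp (fun y : R => y) l), continuous_id.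
Qed.

Lemma filterlim_R_le {T : Type} (F : (T -> Prop) -> Prop) {FF : ProperFilter F}
  (f g : T -> R) (lf lg : R) :
  F (fun x => f x <= g x) ->
  filterlim f F (locally lf) -> filterlim g F (locally lg) -> lf <= lg.
Proof.
  intros H Hf Hg.
  exact (filterlim_le (F := F) f g (Finite lf) (Finite lg) H Hf Hg).
Qed.

Lemma filterlim_R_unique {T : Type} (F : (T -> Prop) -> Prop) {FF : ProperFilter F}
  (f : T -> R) (l l' : R) :
  filterlim f F (locally l) -> filterlim f F (locally l') -> l = l'.
Proof. apply (filterlim_locally_unique (V := R_NormedModule) f). Qed.

(** Balls of [C] are products of real balls, so each limit in [C] splits into two real ones. The
    filter is kept arbitrary because the same rules are used along [locally t], its restrictions by
    [within], [Riemann_fine] and the filters at the endpoints. *)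
Lemma filterlim_C {T : Type} (F : (T -> Prop) -> Prop) {FF : Filter F}
  (g : T -> C) (l : C) :
  filterlim g F (locally l) <->
  filterlim (fun x => Re (g x)) F (locally (Re l)) /\
  filterlim (fun x => Im (g x)) F (locally (Im l)).
Proof.
  split.
  - intros H. split.
    + eapply filterlim_comp; [exact H |].
      intros P [e He]. exists e. intros y Hy. apply He. apply Hy.
    + eapply filterlim_comp; [exact H |].
      intros P [e He]. exists e. intros y Hy. apply He. apply Hy.
  - intros [H1 H2] P [e He].
    assert (A1 := H1 (fun y => ball (Re l) e y) (ex_intro _ e (fun y Hy => Hy))).
    assert (A2 := H2 (fun y => ball (Im l) e y) (ex_intro _ e (fun y Hy => Hy))).
    unfold filtermap in *.
    generalize (filter_and _ _ A1 A2); apply filter_imp.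
    intros x [B1 B2]. apply He. split; assumption.
Qed.

Lemma filterlim_Cplus {T : Type} (F : (T -> Prop) -> Prop) {FF : Filter F}
  (f g : T -> C) (lf lg : C) :
  filterlim f F (locally lf) -> filterlim g F (locally lg) ->
  filterlim (fun x => Cplus (f x) (g x)) F (locally (Cplus lf lg)).
Proof.
  intros Hf Hg. apply (filterlim_C F) in Hf; apply (filterlim_C F) in Hg.
  apply (filterlim_C F).
  split; apply (filterlim_R_plus F); tauto.
Qed.

Lemma filterlim_Cmult {T : Type} (F : (T -> Prop) -> Prop) {FF : Filter F}
  (f g : T -> C) (lf lg : C) :
  filterlim f F (locally lf) -> filterlim g F (locally lg) ->
  filterlim (fun x => Cmult (f x) (g x)) F (locally (Cmult lf lg)).
Proof.
  intros Hf Hg. apply (filterlim_C F) in Hf; apply (filterlim_C F) in Hg.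
  apply (filterlim_C F).
  split.
  - apply (filterlim_R_minus F); apply (filterlim_R_mult F); tauto.
  - apply (filterlim_R_plus F); apply (filterlim_R_mult F); tauto.
Qed.

Lemma filterlim_Cminus {T : Type} (F : (T -> Prop) -> Prop) {FF : Filter F}
  (f g : T -> C) (lf lg : C) :
  filterlim f F (locally lf) -> filterlim g F (locally lg) ->
  filterlim (fun x => Cminus (f x) (g x)) F (locally (Cminus lf lg)).
Proof.
  intros Hf Hg. apply (filterlim_C F) in Hf; apply (filterlim_C F) in Hg.
  apply (filterlim_C F).
  split; apply (filterlim_R_minus F); tauto.
Qed.

Lemma filterlim_Cinv {T : Type} (F : (T -> Prop) -> Prop) {FF : Filter F}
  (f : T -> C) (l : C) :
  l <> RtoC 0 -> filterlim f F (locally l) ->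
  filterlim (fun x => Cinv (f x)) F (locally (Cinv l)).
Proof.
  intros Hl Hf. apply (filterlim_C F) in Hf. destruct Hf as [Hf1 Hf2].
  (* The factors 1 come from unfolding the squares in [Cinv]; with the denominator in this form the
     two components of [Cinv] match by conversion. *)
  assert (D : Re l * (Re l * 1) + Im l * (Im l * 1) <> 0).
  { intros E. apply Hl. destruct l as [a b]; simpl in *.
    assert (a = 0) by nra. assert (b = 0) by nra. subst. reflexivity. }
  assert (Hd : filterlim (fun x => Re (f x) * (Re (f x) * 1) + Im (f x) * (Im (f x) * 1)) F
     (locally (Re l * (Re l * 1) + Im l * (Im l * 1)))).
  { apply (filterlim_R_plus F); repeat apply (filterlim_R_mult F);
      try assumption; apply filterlim_const. }
  apply (filterlim_R_inv F _ _ D) in Hd.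
  apply (filterlim_C F).
  split.
  - exact (filterlim_R_mult F _ _ _ _ Hf1 Hd).
  - refine (filterlim_R_mult F _ _ _ _ _ Hd).
    apply (filterlim_comp _ _ _ (fun x => Im (f x)) Ropp _ _ _ Hf2).
    apply (filterlim_opp (V := R_NormedModule)).
Qed.

Lemma filterlim_Cdiv {T : Type} (F : (T -> Prop) -> Prop) {FF : Filter F}
  (f g : T -> C) (lf lg : C) :
  lg <> RtoC 0 -> filterlim f F (locally lf) -> filterlim g F (locally lg) ->
  filterlim (fun x => Cdiv (f x) (g x)) F (locally (Cdiv lf lg)).
Proof.
  intros Hl Hf Hg. apply (filterlim_Cmult F); [exact Hf |].
  apply (filterlim_Cinv F); assumption.
Qed.

Lemma Cmod_opp_sub (a b : C) : Cmod (Cminus a b) = Cmod (Cminus b a).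
Proof. rewrite <- Cmod_opp. f_equal. ring. Qed.

Lemma Cmod_le_abs (z : C) : Cmod z <= Rabs (Re z) + Rabs (Im z).
Proof.
  destruct z as [a b]. simpl.
  replace (a, b) with (Cplus (RtoC a) (Cmult Ci (RtoC b))).
  2:{ unfold Cplus, Cmult, Ci, RtoC; simpl; f_equal; ring. }
  eapply Rle_trans; [apply Cmod_triangle |].
  rewrite Cmod_mult, Cmod_R, Cmod_Ci, Cmod_R. lra.
Qed.

Lemma im_le_Cmod (z : C) : Rabs (Im z) <= Cmod z.
Proof.
  eapply Rle_trans; [| apply Rmax_Cmod]. apply Rmax_r.
Qed.

Lemma filterlim_Cmod {T : Type} (F : (T -> Prop) -> Prop) {FF : Filter F}
  (g : T -> C) (l : C) :
  filterlim g F (locally l) -> filterlim (fun x => Cmod (g x)) F (locally (Cmod l)).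
Proof.
  intros H. apply (filterlim_C F) in H. destruct H as [H1 H2].
  apply (filterlim_R_eps F). intros eps He.
  assert (He2 : 0 < eps / 2) by lra.
  generalize (filter_and _ _ (proj1 (filterlim_R_eps F _ _) H1 _ He2)
                (proj1 (filterlim_R_eps F _ _) H2 _ He2)).
  apply filter_imp. intros x [A B].
  assert (D := Cmod_le_abs (Cminus (g x) l)).
  replace (Re (Cminus (g x) l)) with (Re (g x) - Re l) in D by reflexivity.
  replace (Im (Cminus (g x) l)) with (Im (g x) - Im l) in D by reflexivity.
  assert (T1 := Cmod_triangle (Cminus (g x) l) l).
  replace (Cplus (Cminus (g x) l) l) with (g x) in T1 by ring.
  assert (T2 := Cmod_triangle (Cminus l (g x)) (g x)).
  replace (Cplus (Cminus l (g x)) (g x)) with l in T2 by ring.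
  rewrite (Cmod_opp_sub l) in T2.
  apply Rabs_def1; lra.
Qed.

Lemma filterlim_C_cauchy {T : Type} (F : (T -> Prop) -> Prop) {FF : ProperFilter F}
  (g : T -> C) :
  (forall eps, 0 < eps -> exists P : T -> Prop, F P /\
     forall u v, P u -> P v -> Cmod (Cminus (g v) (g u)) < eps) ->
  exists l : C, filterlim g F (locally l).
Proof.
  intros Hc.
  assert (Hre : exists a : R, filterlim (fun w => Re (g w)) F (locally a)).
  { apply (filterlim_locally_cauchy (U := R_CompleteSpace) (F := F)).
    intros eps. destruct (Hc eps (cond_pos eps)) as (P & HP & HPc). exists P.
    split; [exact HP |].
    intros u v Hu Hv. apply Rle_lt_trans with (2 := HPc u v Hu Hv).
    apply (re_le_Cmod (Cminus (g v) (g u))). }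
  assert (Him : exists b : R, filterlim (fun w => Im (g w)) F (locally b)).
  { apply (filterlim_locally_cauchy (U := R_CompleteSpace) (F := F)).
    intros eps. destruct (Hc eps (cond_pos eps)) as (P & HP & HPc). exists P.
    split; [exact HP |].
    intros u v Hu Hv. apply Rle_lt_trans with (2 := HPc u v Hu Hv).
    apply (im_le_Cmod (Cminus (g v) (g u))). }
  destruct Hre as [a Ha]; destruct Him as [b Hb]. exists (a, b).
  apply (filterlim_C F). split; assumption.
Qed.

(** * Equivalence of norms on [vec n] *)

Definition vcons {n : nat} (a : C) (v : vec n) : vec (S n) :=
  fun i => Fin.caseS' i (fun _ => C) a v.
Definition vtail {n : nat} (v : vec (S n)) : vec n := fun i => v (Fin.FS i).
Definition vplus {n : nat} (v w : vec n) : vec n := fun i => Cplus (v i) (w i).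
Definition vscal {n : nat} (c : C) (v : vec n) : vec n := fun i => Cmult c (v i).
Definition vminus {n : nat} (v w : vec n) : vec n := fun i => Cminus (v i) (w i).
Definition vzero {n : nat} : vec n := fun _ => RtoC 0.

Lemma vec0_eq (v w : vec 0) : v = w.
Proof. extensionality i. inversion i. Qed.

Lemma vnorm_zero {n : nat} (N : vec n -> R) (HN : is_norm N) : N vzero = 0.
Proof. destruct HN as (_ & H & _). apply H. reflexivity. Qed.

Lemma vnorm_triangle {n : nat} (N : vec n -> R) (HN : is_norm N) (v w : vec n) :
  N (vplus v w) <= N v + N w.
Proof. destruct HN as (_ & _ & _ & H). apply H. Qed.

Lemma vnorm_scal {n : nat} (N : vec n -> R) (HN : is_norm N) (c : C) (v : vec n) :
  N (vscal c v) = Cmod c * N v.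
Proof. destruct HN as (_ & _ & H & _). apply H. Qed.

Lemma vnorm_minus_sym {n : nat} (N : vec n -> R) (HN : is_norm N) (v w : vec n) :
  N (vminus v w) = N (vminus w v).
Proof.
  replace (vminus v w) with (vscal (Copp (RtoC 1)) (vminus w v)).
  - rewrite (vnorm_scal N HN), Cmod_opp, Cmod_1. ring.
  - extensionality i. unfold vscal, vminus. ring.
Qed.

Lemma vnorm_sub_triangle {n : nat} (N : vec n -> R) (HN : is_norm N) (u v w : vec n) :
  N (vminus u w) <= N (vminus u v) + N (vminus v w).
Proof.
  replace (vminus u w) with (vplus (vminus u v) (vminus v w)).
  - apply vnorm_triangle, HN.
  - extensionality i. unfold vplus, vminus. ring.
Qed.

(** Restricting a norm to the hyperplane of vanishing first coordinate is what allows induction on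
    the dimension in both comparisons of [N] with the coordinates. *)
Lemma vnorm_tail {n : nat} (N : vec (S n) -> R) (HN : is_norm N) :
  is_norm (fun w : vec n => N (vcons (RtoC 0) w)).
Proof.
  destruct HN as (H1 & H2 & H3 & H4). repeat split.
  - intros v. apply H1.
  - intros H. apply H2 in H. extensionality i.
    apply (f_equal (fun g => g (Fin.FS i)) H).
  - intros ->. apply H2. extensionality i. unfold vcons.
    apply (Fin.caseS' i); reflexivity.
  - intros c v. rewrite <- H3. f_equal. extensionality i. unfold vcons.
    apply (Fin.caseS' i); simpl; [ring | reflexivity].
  - intros v w. eapply Rle_trans; [| apply H4]. right. f_equal.
    extensionality i. unfold vcons.
    apply (Fin.caseS' i); simpl; [ring | reflexivity].
Qed.

(** Expand [v] in the standard basis: the induction builds [K] as the sum of the norms of the basis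
    vectors. A common bound [d] on the coordinates stands in for a maximum norm. *)
Lemma norm_le_components {n : nat} (N : vec n -> R) (HN : is_norm N) :
  exists K, 0 <= K /\ forall (v : vec n) d, 0 <= d ->
    (forall i, Cmod (v i) <= d) -> N v <= K * d.
Proof.
  revert N HN. induction n as [| n IH]; intros N HN.
  - exists 0. split; [lra |]. intros v d _ _.
    rewrite (vec0_eq v vzero), (vnorm_zero N HN). lra.
  - destruct (IH _ (vnorm_tail N HN)) as (K & HK & H).
    set (e := vcons (RtoC 1) vzero : vec (S n)).
    exists (N e + K). split.
    + assert (0 <= N e) by apply HN. lra.
    + intros v d Hd Hv.
      replace v with (vplus (vscal (v Fin.F1) e) (vcons (RtoC 0) (vtail v))).
      2:{ extensionality i. unfold vplus, vscal, e, vcons.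
          apply (Fin.caseS' i); simpl; [ring | intros; unfold vzero, vtail; ring]. }
      eapply Rle_trans; [apply (vnorm_triangle N HN) |].
      rewrite (vnorm_scal N HN).
      assert (A := H (vtail v) d Hd (fun i => Hv (Fin.FS i))).
      assert (B := Hv Fin.F1). assert (0 <= N e) by apply HN.
      assert (Cmod (v Fin.F1) * N e <= d * N e) by (apply Rmult_le_compat_r; assumption).
      lra.
Qed.

Lemma Fin_choice {A : Type} {n : nat} (Q : Fin.t n -> A -> Prop) :
  (forall i, exists y, Q i y) -> exists w : Fin.t n -> A, forall i, Q i (w i).
Proof.
  revert Q. induction n as [| n IH]; intros Q HQ.
  - exists (fun i => Fin.case0 (fun _ => A) i). intros i. inversion i.
  - destruct (HQ Fin.F1) as [a Ha].
    destruct (IH (fun i => Q (Fin.FS i)) (fun i => HQ (Fin.FS i))) as [w Hw].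
    exists (fun i => Fin.caseS' i (fun _ => A) a w).
    intros i. apply (Fin.caseS' i); assumption.
Qed.

Lemma filter_forall_Fin {T : Type} (F : (T -> Prop) -> Prop) {FF : Filter F} (n : nat)
  (P : Fin.t n -> T -> Prop) :
  (forall i, F (P i)) -> F (fun x => forall i, P i x).
Proof.
  induction n as [| n IH]; intros H.
  - apply filter_forall. intros x i. inversion i.
  - generalize (filter_and _ _ (H Fin.F1) (IH _ (fun i => H (Fin.FS i)))).
    apply filter_imp. intros x [A B] i. apply (Fin.caseS' i); assumption.
Qed.

(** Reverse triangle inequality combined with the upper comparison [norm_le_components]. The lower
    comparison is itself derived from this continuity, so it cannot be invoked here. *)
Lemma filterlim_norm_vec {T : Type} (F : (T -> Prop) -> Prop) {FF : Filter F} {n : nat}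
  (N : vec n -> R) (HN : is_norm N) (g : T -> vec n) (l : vec n) :
  (forall i, filterlim (fun x => g x i) F (locally (l i))) ->
  filterlim (fun x => N (g x)) F (locally (N l)).
Proof.
  intros H. destruct (norm_le_components N HN) as (K & HK & Hle).
  apply filterlim_R_eps; [exact FF |]. intros eps He.
  (* [K] may be 0; the divisor [K + 1] stays positive and gives [K * d < eps] through
     [K * d + d = eps]. The same device recurs in the later Cauchy arguments. *)
  set (d := eps / (K + 1)).
  assert (Hd : 0 < d) by (apply Rdiv_lt_0_compat; lra).
  assert (A : F (fun x => forall i, Cmod (Cminus (g x i) (l i)) < d)).
  { apply filter_forall_Fin; [exact FF |]. intros i.
    assert (B := filterlim_Cmod F _ _
                   (filterlim_Cminus F _ _ _ _ (H i) (filterlim_const (l i)))).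
    replace (Cminus (l i) (l i)) with (RtoC 0) in B by ring. rewrite Cmod_0 in B.
    generalize (proj1 (filterlim_R_eps F _ _) B d Hd). apply filter_imp.
    intros x Hx. apply Rabs_def2 in Hx. lra. }
  revert A. apply filter_imp. intros x Hx.
  assert (B : N (vminus (g x) l) <= K * d).
  { apply Hle; [lra |]. intros i. left. apply Hx. }
  assert (C1 : K * d < eps).
  { assert (K * d + d = eps) by (unfold d; field; lra). lra. }
  assert (T1 := vnorm_triangle N HN (vminus (g x) l) l).
  assert (T2 := vnorm_triangle N HN (vminus l (g x)) (g x)).
  rewrite (vnorm_minus_sym N HN l) in T2.
  replace (vplus (vminus (g x) l) l) with (g x) in T1
    by (extensionality i; unfold vplus, vminus; ring).
  replace (vplus (vminus l (g x)) (g x)) with l in T2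
    by (extensionality i; unfold vplus, vminus; ring).
  apply Rabs_def1; lra.
Qed.

(* Equivalence of norms without compactness: the first coordinate is a bounded functional
   because the hyperplane [v F1 = 0], complete by induction, does not approach [e]. *)
Lemma components_le_norm {n : nat} (N : vec n -> R) (HN : is_norm N) :
  exists K, 0 <= K /\ forall (v : vec n) i, Cmod (v i) <= K * N v.
Proof.
  revert N HN. induction n as [| n IH]; intros N HN.
  - exists 0. split; [lra |]. intros v i. inversion i.
  - pose proof (vnorm_tail N HN) as HT.
    destruct (IH _ HT) as (K & HK & H).
    set (e := vcons (RtoC 1) vzero : vec (S n)).
    assert (Hd : exists d, 0 < d /\ forall w : vec n, d <= N (vcons (RtoC 1) w)).
    { apply NNPP. intros Hno.
      (* [F] is the filter of [w] for which the norm of [(1, w)] tends to 0. The contradiction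
         hypothesis, that these norms have no positive lower bound, is what makes it proper; a limit
         [w] along [F] would have first coordinate 1 and yet norm 0. *)
      set (F := fun P : vec n -> Prop =>
        exists d, 0 < d /\ forall w, N (vcons (RtoC 1) w) < d -> P w).
      assert (FF : ProperFilter F).
      { constructor.
        - intros P (d & Hd & HP). apply NNPP. intros Hn. apply Hno.
          exists d. split; [exact Hd |]. intros w.
          destruct (Rle_lt_dec d (N (vcons (RtoC 1) w))) as [h | h]; [exact h |].
          exfalso. apply Hn. exists w. apply HP, h.
        - constructor.
          + exists 1. split; [lra |]. trivial.
          + intros P Q (d & Hd & HP) (d' & Hd' & HQ).
            exists (Rmin d d'). split; [apply Rmin_pos; assumption |].
            intros w Hw. split.
            * apply HP. eapply Rlt_le_trans; [exact Hw | apply Rmin_l].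
            * apply HQ. eapply Rlt_le_trans; [exact Hw | apply Rmin_r].
          + intros P Q HPQ (d & Hd & HP). exists d. split; [exact Hd |].
            intros w Hw. apply HPQ, HP, Hw. }
      assert (Hl : forall i, exists y : C, filterlim (fun w : vec n => w i) F (locally y)).
      { intros i.
        apply (filterlim_C_cauchy F). intros eps He.
        set (d := eps / (2 * (K + 1))).
        assert (Hd : 0 < d) by (apply Rdiv_lt_0_compat; lra).
        exists (fun w => N (vcons (RtoC 1) w) < d). split.
        { exists d. split; [exact Hd |]. intros w Hw. exact Hw. }
        intros u v Hu Hv.
        (* The difference of [(1, v)] and [(1, u)] lies in the hyperplane, where the induction
           hypothesis turns a small norm into small coordinates. *)
        assert (A : N (vcons (RtoC 0) (vminus v u)) < 2 * d).
        { replace (vcons (RtoC 0) (vminus v u))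
            with (vminus (vcons (RtoC 1) v) (vcons (RtoC 1) u)).
          - assert (B := vnorm_sub_triangle N HN (vcons (RtoC 1) v) vzero (vcons (RtoC 1) u)).
            rewrite (vnorm_minus_sym N HN vzero) in B.
            assert (Z : forall x : vec (S n), vminus x vzero = x).
            { intros x. extensionality j. unfold vminus, vzero. ring. }
            rewrite !Z in B. lra.
          - extensionality j. unfold vminus, vcons.
            apply (Fin.caseS' j); simpl; [ring | reflexivity]. }
        assert (B := H (vminus v u) i).
        assert (D : Cmod (vminus v u i) < eps).
        { eapply Rle_lt_trans; [exact B |].
          apply Rle_lt_trans with (K * (2 * d)).
          - apply Rmult_le_compat_l; lra.
          - assert (K * (2 * d) + 2 * d = eps) by (unfold d; field; lra). lra. }
        exact D. }
      assert (Hw : exists w : vec n, forall i, filterlim (fun w : vec n => w i) F (locally (w i))).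
      { apply (Fin_choice (fun i y => filterlim (fun w : vec n => w i) F (locally y)) Hl). }
      destruct Hw as [w Hw].
      assert (A : filterlim (fun w => N (vcons (RtoC 1) w)) F (locally (N (vcons (RtoC 1) w)))).
      { apply (filterlim_norm_vec F N HN (fun w => vcons (RtoC 1) w)).
        intros i. apply (Fin.caseS' i); simpl; [apply filterlim_const | exact Hw]. }
      assert (B : filterlim (fun w => N (vcons (RtoC 1) w)) F (locally 0)).
      { apply filterlim_R_eps; [apply FF |]. intros eps He. exists eps. split; [exact He |].
        intros x Hx. rewrite Rminus_0_r, Rabs_pos_eq; [exact Hx | apply HN]. }
      assert (E := filterlim_R_unique F _ _ _ A B).
      apply HN in E. apply (f_equal (fun g => Re (g Fin.F1))) in E. simpl in E. lra. }
    destruct Hd as (d & Hd & Hlow).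
    assert (A : forall v : vec (S n), Cmod (v Fin.F1) <= / d * N v).
    { intros v. destruct (Ceq_dec (v Fin.F1) (RtoC 0)) as [E | E].
      - rewrite E, Cmod_0. apply Rmult_le_pos; [left; apply Rinv_0_lt_compat, Hd | apply HN].
      - assert (B := Hlow (vscal (Cinv (v Fin.F1)) (vtail v))).
        replace (vcons (RtoC 1) (vscal (Cinv (v Fin.F1)) (vtail v)))
          with (vscal (Cinv (v Fin.F1)) v) in B.
        + rewrite (vnorm_scal N HN), (Cmod_inv _ E) in B.
          assert (P := proj1 (Cmod_gt_0 _) E).
          apply (Rmult_le_compat_l (Cmod (v Fin.F1) * / d)) in B.
          2:{ apply Rmult_le_pos; [lra | left; apply Rinv_0_lt_compat, Hd]. }
          replace (Cmod (v Fin.F1) * / d * d) with (Cmod (v Fin.F1)) in B by (field; lra).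
          replace (Cmod (v Fin.F1) * / d * (/ Cmod (v Fin.F1) * N v))
            with (/ d * N v) in B by (field; lra).
          exact B.
        + extensionality i. unfold vscal, vcons.
          apply (Fin.caseS' i); simpl; [field; exact E | reflexivity]. }
    assert (Hi : 0 < / d) by (apply Rinv_0_lt_compat, Hd).
    assert (He : 0 <= N e) by apply HN.
    (* The first summand controls the first coordinate. The second controls the others: subtracting
       [v F1] times [e] leaves a vector of the hyperplane of norm at most [(1 + / d * N e) * N v],
       to which the constant [K] of the induction applies. *)
    exists (/ d + K * (1 + / d * N e)). split.
    + assert (0 <= / d * N e) by (apply Rmult_le_pos; lra).
      assert (0 <= K * (1 + / d * N e)) by (apply Rmult_le_pos; lra). lra.
    + intros v i.
      assert (Nv : 0 <= N v) by apply HN.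
      assert (0 <= / d * N v) by (apply Rmult_le_pos; lra).
      assert (B : N (vcons (RtoC 0) (vtail v)) <= (1 + / d * N e) * N v).
      { replace (vcons (RtoC 0) (vtail v)) with (vplus v (vscal (Copp (v Fin.F1)) e)).
        - eapply Rle_trans; [apply (vnorm_triangle N HN) |].
          rewrite (vnorm_scal N HN), Cmod_opp.
          assert (Cmod (v Fin.F1) * N e <= / d * N v * N e)
            by (apply Rmult_le_compat_r; [exact He | apply A]).
          lra.
        - extensionality j. unfold vplus, vscal, e, vcons.
          apply (Fin.caseS' j); simpl; [ring | intros; unfold vzero, vtail; ring]. }
      assert (0 <= K * ((1 + / d * N e) * N v)).
      { apply Rmult_le_pos; [lra |]. eapply Rle_trans; [| exact B]. apply HN. }
      apply (Fin.caseS' i).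
      * rewrite Rmult_plus_distr_r. assert (A1 := A v). lra.
      * intros j. assert (D := H (vtail v) j).
        assert (K * N (vcons (RtoC 0) (vtail v)) <= K * ((1 + / d * N e) * N v))
          by (apply Rmult_le_compat_l; assumption).
        unfold vtail at 1 in D. lra.
Qed.

(** * Norms of integrals *)

(** Integrating real and imaginary parts separately keeps the theory of real [RInt] available,
    including Riemann sums as real numbers. *)
Definition CRInt (h : R -> C) (a b : R) : C :=
  (RInt (fun s => Re (h s)) a b, RInt (fun s => Im (h s)) a b).

Definition ex_CRInt (h : R -> C) (a b : R) : Prop :=
  ex_RInt (fun s => Re (h s)) a b /\ ex_RInt (fun s => Im (h s)) a b.

Lemma pointed_subdiv_head_le_last (s : SF_seq) :
  pointed_subdiv s -> SF_h s <= seq.last (SF_h s) (SF_lx s).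
Proof.
  intros H. apply ptd_sort in H.
  apply (sorted_last (SF_lx s) 0 H) with (x0 := SF_h s).
  unfold SF_lx; simpl. lia.
Qed.

(** A Riemann sum of vectors is a combination with nonnegative weights, so the norm passes inside
    with constant 1. The domination is assumed only between the first and last subdivision points,
    and the induction shrinks that range from the left. *)
Lemma norm_Riemann_sum_le {n : nat} (N : vec n -> R) (HN : is_norm N)
  (h : R -> vec n) (g : R -> R) (ptd : SF_seq) :
  pointed_subdiv ptd ->
  (forall t, SF_h ptd <= t <= seq.last (SF_h ptd) (SF_lx ptd) -> N (h t) <= g t) ->
  N (fun i => (Riemann_sum (fun s => Re (h s i)) ptd,
               Riemann_sum (fun s => Im (h s i)) ptd)) <= Riemann_sum g ptd.
Proof.
  apply SF_cons_ind with (s := ptd); clear ptd.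
  - intros x0 _ _. right. apply (vnorm_zero N HN).
  - intros h0 s IH Hs Hb.
    assert (H0 := Hs 0%nat (PeanoNat.Nat.lt_0_succ _)). simpl in H0.
    assert (Hs' := ptd_cons _ _ Hs).
    assert (Hl := pointed_subdiv_head_le_last s Hs').
    assert (IH' := IH Hs').
    destruct s as [sh st]. simpl in *. unfold SF_h in *. simpl in *.
    change (SF_lx (SF_cons h0 {| SF_h := sh; SF_t := st |}))
      with (cons (fst h0) (SF_lx {| SF_h := sh; SF_t := st |})) in Hb.
    simpl in Hb.
    rewrite Riemann_sum_cons. simpl.
    replace (fun i => _) with
      (vplus (vscal (RtoC (sh - fst h0)) (h (snd h0)))
         (fun i => (Riemann_sum (fun s => Re (h s i)) {| SF_h := sh; SF_t := st |},
                    Riemann_sum (fun s => Im (h s i)) {| SF_h := sh; SF_t := st |}))).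
    2:{ extensionality i. rewrite !Riemann_sum_cons. 
        unfold vplus, vscal, Cplus, Cmult, RtoC, Re, Im, plus, scal; simpl.
        unfold mult; simpl. f_equal; ring. }
    eapply Rle_trans; [apply (vnorm_triangle N HN) |].
    apply Rplus_le_compat.
    + rewrite (vnorm_scal N HN), Cmod_R, Rabs_pos_eq by lra.
      apply Rmult_le_compat_l; [lra |]. apply Hb. lra.
    + apply IH'. intros t Ht. apply Hb. lra.
Qed.

Lemma CRInt_swap (h : R -> C) (a b : R) :
  ex_CRInt h a b -> CRInt h b a = Copp (CRInt h a b).
Proof.
  intros [H1 H2]. unfold CRInt, Copp. simpl.
  rewrite <- (opp_RInt_swap _ _ _ H1), <- (opp_RInt_swap _ _ _ H2). reflexivity.
Qed.

(** All the components converge along the one filter [Riemann_fine a b], so the inequality for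
    Riemann sums passes to the limit by continuity of [N], without any factor from equivalence of
    norms. *)
Lemma norm_CRInt_le_ordered {n : nat} (N : vec n -> R) (HN : is_norm N)
  (h : R -> vec n) (g : R -> R) (a b : R) :
  a < b -> (forall i, ex_CRInt (fun s => h s i) a b) -> ex_RInt g a b ->
  (forall s, a <= s <= b -> N (h s) <= g s) ->
  N (fun i => CRInt (fun s => h s i) a b) <= RInt g a b.
Proof.
  intros Hab Hh Hg Hb.
  assert (Hsg : sign (b - a) = 1) by (apply sign_eq_1; lra).
  assert (Lg := RInt_correct _ _ _ Hg). unfold is_RInt in Lg.
  assert (FF : ProperFilter (Riemann_fine a b)) by apply Riemann_fine_filter.
  refine (filterlim_R_le (Riemann_fine a b)
    (fun ptd => N (fun i => (scal (sign (b - a)) (Riemann_sum (fun s => Re (h s i)) ptd),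
                          scal (sign (b - a)) (Riemann_sum (fun s => Im (h s i)) ptd))))
    _ _ _ _ _ Lg).
  (* The mesh bound 1 is arbitrary: the inequality holds for every pointed subdivision of the
     interval. *)
  - unfold Riemann_fine, within, locally_dist. exists (mkposreal 1 Rlt_0_1).
    intros ptd _ (H1 & H2 & H3). rewrite Hsg.
    unfold scal; simpl; unfold mult; simpl.
    rewrite Rmult_1_l.
    replace (fun i => _) with
      (fun i => (Riemann_sum (fun s => Re (h s i)) ptd, Riemann_sum (fun s => Im (h s i)) ptd)).
    2:{ extensionality i. f_equal; symmetry; apply Rmult_1_l. }
    apply (norm_Riemann_sum_le N HN); [exact H1 |].
    rewrite H3, H2, Rmin_left, Rmax_right by lra. exact Hb.
  - apply (filterlim_norm_vec (Riemann_fine a b) N HN).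
    intros i. apply (filterlim_C (Riemann_fine a b)). destruct (Hh i) as [E1 E2]. split.
    + exact (RInt_correct _ _ _ E1).
    + exact (RInt_correct _ _ _ E2).
Qed.

Lemma norm_CRInt_le {n : nat} (N : vec n -> R) (HN : is_norm N)
  (h : R -> vec n) (g : R -> R) (a b : R) :
  (forall i, ex_CRInt (fun s => h s i) a b) -> ex_RInt g a b ->
  (forall s, Rmin a b <= s <= Rmax a b -> N (h s) <= g s) ->
  N (fun i => CRInt (fun s => h s i) a b) <= Rabs (RInt g a b).
Proof.
  intros Hh Hg Hb. destruct (Rtotal_order a b) as [L | [-> | L]].
  - rewrite Rmin_left, Rmax_right in Hb by lra.
    eapply Rle_trans; [apply (norm_CRInt_le_ordered N HN h g); assumption |].
    apply Rle_abs.
  - replace (fun i => CRInt (fun s => h s i) b b) with (@vzero n).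
    + rewrite (vnorm_zero N HN). apply Rabs_pos.
    + extensionality i. unfold CRInt. rewrite !RInt_point. reflexivity.
  - rewrite Rmin_right, Rmax_left in Hb by lra.
    assert (Hg' := ex_RInt_swap _ _ _ Hg).
    assert (Hh' : forall i, ex_CRInt (fun s => h s i) b a).
    { intros i. destruct (Hh i). split; apply ex_RInt_swap; assumption. }
    rewrite <- (opp_RInt_swap _ _ _ Hg').
    change (opp (RInt g b a)) with (- RInt g b a). rewrite Rabs_Ropp.
    replace (fun i => CRInt (fun s => h s i) a b)
      with (vscal (Copp (RtoC 1)) (fun i => CRInt (fun s => h s i) b a)).
    + rewrite (vnorm_scal N HN), Cmod_opp, Cmod_1, Rmult_1_l.
      eapply Rle_trans; [apply (norm_CRInt_le_ordered N HN h g); assumption |].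
      apply Rle_abs.
    + extensionality i. rewrite (CRInt_swap _ b a (Hh' i)). unfold vscal. ring.
Qed.

(** * First-order equations *)

Definition convex_set (J : R -> Prop) : Prop :=
  forall a b x, J a -> J b -> Rmin a b <= x <= Rmax a b -> J x.

(** Continuity here is two-sided, in contrast with [ccont_on], which is relative to its set; it is
    meant for the open set [J] around the interval. *)
Definition continuous_in (J : R -> Prop) (g : R -> R) : Prop :=
  forall t, J t -> continuous g t.

Definition Ccontinuous_in (J : R -> Prop) (g : R -> C) : Prop :=
  forall t, J t -> filterlim g (locally t) (locally (g t)).

Lemma Ccontinuous_in_components (J : R -> Prop) (g : R -> C) :
  Ccontinuous_in J g ->
  continuous_in J (fun s => Re (g s)) /\ continuous_in J (fun s => Im (g s)).
Proof.
  intros H. split; intros t Ht; apply (filterlim_C (locally t) _ _) in H; try exact Ht; apply H.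
Qed.

Lemma ex_RInt_in (J : R -> Prop) (g : R -> R) (a b : R) :
  convex_set J -> continuous_in J g -> J a -> J b -> ex_RInt g a b.
Proof.
  intros HJ Hg Ha Hb. apply (ex_RInt_continuous (V := R_CompleteNormedModule)).
  intros z Hz. apply Hg, (HJ a b); assumption.
Qed.

Lemma ex_CRInt_in (J : R -> Prop) (g : R -> C) (a b : R) :
  convex_set J -> Ccontinuous_in J g -> J a -> J b -> ex_CRInt g a b.
Proof.
  intros HJ Hg Ha Hb. destruct (Ccontinuous_in_components J g Hg).
  split; apply (ex_RInt_in J); assumption.
Qed.

Lemma RInt_Chasles_in (J : R -> Prop) (g : R -> R) (a b c : R) :
  convex_set J -> continuous_in J g -> J a -> J b -> J c ->
  RInt g a c = RInt g a b + RInt g b c.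
Proof.
  intros HJ Hg Ha Hb Hc. symmetry.
  apply (RInt_Chasles (V := R_CompleteNormedModule)); apply (ex_RInt_in J); assumption.
Qed.

Lemma RInt_swap_in (J : R -> Prop) (g : R -> R) (a b : R) :
  convex_set J -> continuous_in J g -> J a -> J b -> RInt g b a = - RInt g a b.
Proof.
  intros HJ Hg Ha Hb. symmetry.
  apply (opp_RInt_swap (V := R_CompleteNormedModule)); apply (ex_RInt_in J); assumption.
Qed.

Lemma RInt_scal_in (J : R -> Prop) (g : R -> R) (k a b : R) :
  convex_set J -> continuous_in J g -> J a -> J b ->
  RInt (fun s => k * g s) a b = k * RInt g a b.
Proof.
  intros HJ Hg Ha Hb.
  apply (RInt_scal (V := R_CompleteNormedModule)); apply (ex_RInt_in J); assumption.
Qed.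

Lemma RInt_ext_R (f g : R -> R) (a b : R) :
  (forall x, Rmin a b < x < Rmax a b -> f x = g x) -> RInt f a b = RInt g a b.
Proof. apply (RInt_ext (V := R_CompleteNormedModule)). Qed.

Lemma CRInt_Chasles_in (J : R -> Prop) (g : R -> C) (a b c : R) :
  convex_set J -> Ccontinuous_in J g -> J a -> J b -> J c ->
  CRInt g a c = Cplus (CRInt g a b) (CRInt g b c).
Proof.
  intros HJ Hg Ha Hb Hc. destruct (Ccontinuous_in_components J g Hg).
  unfold CRInt, Cplus. simpl.
  rewrite <- !(RInt_Chasles_in J) by assumption. reflexivity.
Qed.

Lemma is_derive_primitive (J : R -> Prop) (g : R -> R) (t0 t : R) :
  open J -> convex_set J -> continuous_in J g -> J t0 -> J t ->
  is_derive (fun x => RInt g t0 x) t (g t).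
Proof.
  intros HO HJ Hg H0 Ht. apply (is_derive_RInt g _ t0 t); [| apply Hg, Ht].
  generalize (HO t Ht). apply filter_imp. intros x Hx.
  apply (RInt_correct g), (ex_RInt_in J); assumption.
Qed.

Definition Cderive (g : R -> C) (t : R) (l : C) : Prop :=
  is_derive (fun s => Re (g s)) t (Re l) /\ is_derive (fun s => Im (g s)) t (Im l).

Lemma Cderive_continuous (g : R -> C) (t : R) (l : C) :
  Cderive g t l -> filterlim g (locally t) (locally (g t)).
Proof.
  intros [H1 H2]. apply (filterlim_C (locally t)). split.
  - apply (ex_derive_continuous (K := R_AbsRing) (V := R_NormedModule) (fun s => Re (g s)) t).
    exists (Re l). exact H1.
  - apply (ex_derive_continuous (K := R_AbsRing) (V := R_NormedModule) (fun s => Im (g s)) t).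
    exists (Im l). exact H2.
Qed.

Lemma is_derive_eq (f : R -> R) (t l l' : R) : l = l' -> is_derive f t l -> is_derive f t l'.
Proof. intros ->. trivial. Qed.

Lemma is_derive_Rmult (f g : R -> R) (t df dg : R) :
  is_derive f t df -> is_derive g t dg ->
  is_derive (fun x => f x * g x) t (df * g t + f t * dg).
Proof.
  intros Hf Hg. apply (is_derive_mult (K := R_AbsRing) f g t df dg Hf Hg).
  intros; apply Rmult_comm.
Qed.

Lemma Cderive_eq (f : R -> C) (t : R) (l l' : C) : l = l' -> Cderive f t l -> Cderive f t l'.
Proof. intros ->. trivial. Qed.

Lemma Cderive_mult (f g : R -> C) (t : R) (df dg : C) :
  Cderive f t df -> Cderive g t dg ->
  Cderive (fun x => Cmult (f x) (g x)) t (Cplus (Cmult df (g t)) (Cmult (f t) dg)).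
Proof.
  intros [F1 F2] [G1 G2]. split.
  - eapply is_derive_eq; [| apply (is_derive_minus (V := R_NormedModule));
      [exact (is_derive_Rmult _ _ _ _ _ F1 G1) | exact (is_derive_Rmult _ _ _ _ _ F2 G2)]].
    unfold minus, plus, opp, Re, Im, Cplus, Cmult; simpl. ring.
  - eapply is_derive_eq; [| apply (is_derive_plus (V := R_NormedModule));
      [exact (is_derive_Rmult _ _ _ _ _ F1 G2) | exact (is_derive_Rmult _ _ _ _ _ F2 G1)]].
    unfold minus, plus, opp, Re, Im, Cplus, Cmult; simpl. ring.
Qed.

Lemma Cderive_primitive (J : R -> Prop) (g : R -> C) (t0 t : R) :
  open J -> convex_set J -> Ccontinuous_in J g -> J t0 -> J t ->
  Cderive (fun x => CRInt g t0 x) t (g t).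
Proof.
  intros HO HJ Hg H0 Ht. destruct (Ccontinuous_in_components J g Hg).
  split; simpl; apply (is_derive_primitive J); assumption.
Qed.

Lemma Cderive_const_plus (c : C) (f : R -> C) (t : R) (df : C) :
  Cderive f t df -> Cderive (fun x => Cplus c (f x)) t df.
Proof.
  intros [F1 F2]. split.
  - eapply is_derive_eq; [| apply (is_derive_plus (V := R_NormedModule));
      [apply is_derive_const | exact F1]]. apply Rplus_0_l.
  - eapply is_derive_eq; [| apply (is_derive_plus (V := R_NormedModule));
      [apply is_derive_const | exact F2]]. apply Rplus_0_l.
Qed.

Definition Cexp (z : C) : C := (exp (Re z) * cos (Im z), exp (Re z) * sin (Im z)).

Lemma Cexp_opp_l (z : C) : Cmult (Cexp (Copp z)) (Cexp z) = RtoC 1.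
Proof.
  destruct z as [a b]. unfold Cexp, Cmult, Copp, RtoC; simpl.
  rewrite cos_neg, sin_neg, exp_Ropp.
  assert (E := exp_pos a). assert (S := sin2_cos2 b). unfold Rsqr in S.
  f_equal.
  - transitivity (/ exp a * exp a * (sin b * sin b + cos b * cos b)); [ring |].
    rewrite S. field. lra.
  - ring.
Qed.

(** Taking norms discards the imaginary part of the exponent; this turns the complex integrating
    factors into the real weights of [g1] to [g4]. *)
Lemma Cmod_Cexp (z : C) : Cmod (Cexp z) = exp (Re z).
Proof.
  destruct z as [a b]. unfold Cexp, Cmod; simpl.
  assert (E := exp_pos a). assert (S := sin2_cos2 b). unfold Rsqr in S.
  replace (_ + _) with (exp a * exp a * (sin b * sin b + cos b * cos b)) by ring.
  rewrite S, Rmult_1_r. apply sqrt_square. lra.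
Qed.

Lemma Cderive_Cexp (Q : R -> C) (t : R) (q : C) :
  Cderive Q t q -> Cderive (fun s => Cexp (Q s)) t (Cmult q (Cexp (Q t))).
Proof.
  intros [Q1 Q2].
  assert (E := is_derive_comp (V := R_NormedModule) exp _ t _ _ (is_derive_exp _) Q1).
  assert (D := is_derive_comp (V := R_NormedModule) cos _ t _ _ (is_derive_cos _) Q2).
  assert (S := is_derive_comp (V := R_NormedModule) sin _ t _ _ (is_derive_sin _) Q2).
  split.
  - eapply is_derive_eq; [| exact (is_derive_Rmult _ _ _ _ _ E D)].
    unfold scal, Cexp, Cmult, Re, Im; simpl. unfold mult; simpl. ring.
  - eapply is_derive_eq; [| exact (is_derive_Rmult _ _ _ _ _ E S)].
    unfold scal, Cexp, Cmult, Re, Im; simpl. unfold mult; simpl. ring.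
Qed.

Lemma Cderive_opp (f : R -> C) (t : R) (df : C) :
  Cderive f t df -> Cderive (fun x => Copp (f x)) t (Copp df).
Proof. intros [F1 F2]. split; apply (is_derive_opp (V := R_NormedModule)); assumption. Qed.

(* Variation of constants with the free constant fixed by letting [w] vanish, in the weighted
   sense, at the endpoint [F]; the choice of [F] selects the integrals from tau or to sigma. *)
Lemma first_order_bounded_solution (I J : R -> Prop) (t0 : R)
  (F : (R -> Prop) -> Prop) {FF : ProperFilter F}
  {n : nat} (N : vec n -> R) (HN : is_norm N)
  (q Q : R -> C) (r : R -> vec n) (m Gam : R -> R) :
  open J -> convex_set J -> convex_set I -> (forall t, I t -> J t) -> I t0 -> F I ->
  (forall t, J t -> Cderive Q t (q t)) ->
  (forall i, Ccontinuous_in J (fun s => r s i)) ->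
  continuous_in J m ->
  (forall s, I s -> N (r s) <= m s) ->
  (forall t, I t ->
     filterlim (fun u => RInt (fun s => exp (Re (Q s) - Re (Q t)) * m s) u t) F
               (locally (Gam t))) ->
  exists w : R -> vec n,
    (forall t i, J t -> Cderive (fun s => w s i) t (Cminus (r t i) (Cmult (q t) (w t i)))) /\
    (forall t, I t -> N (w t) <= Rabs (Gam t)).
Proof.
  intros HO HJ HI HIJ H0 FI HQ Hr Hm Hb HG.
  (* Multiplying [w' + q w = r] by [Cexp Q] turns it into [(Cexp Q * w)' = h]; [g] is the scalar
     majorant of the norm of [h]. *)
  set (h := fun s => fun i => Cmult (Cexp (Q s)) (r s i) : C).
  set (g := fun s => exp (Re (Q s)) * m s).
  assert (HQc : Ccontinuous_in J Q) by (intros t Ht; eapply Cderive_continuous, HQ, Ht).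
  assert (Hh : forall i, Ccontinuous_in J (fun s => h s i)).
  { intros i t Ht. apply (filterlim_Cmult (locally t)); [| apply Hr, Ht].
    eapply (Cderive_continuous (fun s => Cexp (Q s))), Cderive_Cexp, HQ, Ht. }
  assert (Hg : continuous_in J g).
  { intros t Ht. apply (filterlim_R_mult (locally t)); [| apply Hm, Ht].
    apply (filterlim_R_exp (locally _)). apply (Ccontinuous_in_components J Q HQc). exact Ht. }
  assert (Hhg : forall s, I s -> N (h s) <= g s).
  { intros s Hs. change (h s) with (vscal (Cexp (Q s)) (r s)). unfold g.
    rewrite (vnorm_scal N HN), Cmod_Cexp.
    apply Rmult_le_compat_l; [left; apply exp_pos | apply Hb, Hs]. }
  assert (Hex : forall i a b, I a -> I b -> ex_CRInt (fun s => h s i) a b).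
  { intros i a b Ha Hb'. apply (ex_CRInt_in J); auto. }
  assert (Hbd : forall a b, I a -> I b ->
            N (fun i => CRInt (fun s => h s i) a b) <= Rabs (RInt g a b)).
  { intros a b Ha Hb'. apply (norm_CRInt_le N HN h g).
    - intros i. apply Hex; assumption.
    - apply (ex_RInt_in J); auto.
    - intros s Hs. apply Hhg, (HI a b); assumption. }
  assert (Hlim : forall t, I t ->
            filterlim (fun u => RInt g u t) F (locally (exp (Re (Q t)) * Gam t))).
  { intros t Ht. apply filterlim_ext_loc with
      (fun u => exp (Re (Q t)) * RInt (fun s => exp (Re (Q s) - Re (Q t)) * m s) u t).
    2:{ apply (filterlim_R_scal F), HG, Ht. }
    generalize FI. apply filter_imp. intros u Hu.
    rewrite <- (RInt_scal_in J); auto.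
    - apply RInt_ext. intros x _. unfold g.
      rewrite <- Rmult_assoc, <- exp_plus. do 2 f_equal. ring.
    - intros s Hs. apply (filterlim_R_mult (locally s)); [| apply Hm, Hs].
      apply (filterlim_R_exp (locally _)).
      apply (filterlim_R_minus (locally s)); [| apply filterlim_const].
      apply (Ccontinuous_in_components J Q HQc), Hs. }
  (* Only the scalar integrals of [g] are known to converge. Their Cauchy property bounds the norm
     of the vector integral from [v] to [u], and [components_le_norm] transfers this to each
     coordinate. *)
  assert (HW : forall i, exists y, filterlim (fun u => CRInt (fun s => h s i) u t0) F (locally y)).
  { intros i. apply (filterlim_C_cauchy F). intros eps He.
    destruct (components_le_norm N HN) as (K & HK & Hcomp).
    set (L := exp (Re (Q t0)) * Gam t0) in *.
    set (d := eps / (2 * (K + 1))).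
    assert (Hd : 0 < d) by (apply Rdiv_lt_0_compat; lra).
    exists (fun u => I u /\ Rabs (RInt g u t0 - L) < d). split.
    { apply filter_and; [exact FI |].
      apply (proj1 (filterlim_R_eps F _ _) (Hlim t0 H0)), Hd. }
    intros u v [Iu Hu] [Iv Hv].
    replace (Cminus _ _) with (CRInt (fun s => h s i) v u).
    2:{ rewrite (CRInt_Chasles_in J (fun s => h s i) v u t0) by auto. ring. }
    eapply Rle_lt_trans; [apply (Hcomp (fun i => CRInt (fun s => h s i) v u) i) |].
    assert (A := Hbd v u Iv Iu).
    assert (B := RInt_Chasles_in J g v u t0 HJ Hg (HIJ _ Iv) (HIJ _ Iu) (HIJ _ H0)).
    assert (D : Rabs (RInt g v u) <= 2 * d).
    { apply Rabs_def2 in Hu; apply Rabs_def2 in Hv. apply Rabs_le; lra. }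
    apply Rle_lt_trans with (K * (2 * d)).
    - apply Rmult_le_compat_l; lra.
    - assert (K * (2 * d) + 2 * d = eps) by (unfold d; field; lra). lra. }
  apply Fin_choice in HW. destruct HW as [W HW].
  exists (fun t i => Cmult (Cexp (Copp (Q t))) (Cplus (W i) (CRInt (fun s => h s i) t0 t))).
  split.
  - intros t i Ht. cbv beta.
    eapply Cderive_eq; [| apply Cderive_mult;
      [apply Cderive_Cexp, Cderive_opp, HQ, Ht
      | apply Cderive_const_plus, (Cderive_primitive J); auto]].
    cbv beta. unfold h at 2.
    rewrite Cmult_assoc, Cexp_opp_l. ring.
  - intros t Ht.
    change (N (vscal (Cexp (Copp (Q t))) (fun i => Cplus (W i) (CRInt (fun s => h s i) t0 t)))
            <= Rabs (Gam t)).
    rewrite (vnorm_scal N HN), Cmod_Cexp.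
    (* [W] is the integral of [h] from the endpoint to [t0], so the vector is the limit of the
       integrals from [u] to [t], and the bound for each [u] survives the limit. *)
    assert (A : N (fun i => Cplus (W i) (CRInt (fun s => h s i) t0 t))
                <= Rabs (exp (Re (Q t)) * Gam t)).
    { apply (filterlim_R_le F (fun u => N (fun i => CRInt (fun s => h s i) u t))
               (fun u => Rabs (RInt g u t))).
      - generalize FI. apply filter_imp. intros u Hu. apply Hbd; assumption.
      - apply (filterlim_norm_vec F N HN). intros i.
        apply filterlim_ext_loc with
          (fun u => Cplus (CRInt (fun s => h s i) u t0) (CRInt (fun s => h s i) t0 t)).
        + generalize FI. apply filter_imp. intros u Hu. symmetry.
          apply (CRInt_Chasles_in J); auto.
        + apply (filterlim_Cplus F); [apply HW | apply filterlim_const].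
      - apply (filterlim_R_abs F), Hlim, Ht. }
    rewrite Rabs_mult, (Rabs_pos_eq (exp _)) in A by (left; apply exp_pos).
    change (Re (Copp (Q t))) with (- Re (Q t)). rewrite exp_Ropp.
    assert (E := exp_pos (Re (Q t))).
    apply Rmult_le_reg_l with (exp (Re (Q t))); [exact E |].
    rewrite <- Rmult_assoc, Rinv_r, Rmult_1_l by lra. exact A.
Qed.

(** * Integrals from an endpoint *)

(* [Io] is the interior of the interval [I]; [s = 1] when [F] tends to the left endpoint and
   [s = -1] when it tends to the right one.  The second alternative in [endpoint_closed] is the
   case where [t] is itself the endpoint. *)
Record endpoint_filter (I Io : R -> Prop) (F : (R -> Prop) -> Prop) (s : R) : Prop := {
  endpoint_proper : ProperFilter F;
  endpoint_sign : s = 1 \/ s = -1;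
  endpoint_in : F Io;
  endpoint_beyond : forall t, Io t -> F (fun u => 0 < s * (t - u));
  endpoint_closed : forall t, I t ->
    F (fun u => 0 < s * (t - u)) \/ filterlim (fun u => u) F (locally t)
}.

Record interval_hull (I Io J : R -> Prop) : Prop := {
  hull_open : open J;
  hull_convex : convex_set J;
  hull_I_convex : convex_set I;
  hull_sub : forall t, I t -> J t;
  hull_interior : forall t, Io t -> I t;
  hull_between : forall u t x, Io u -> I t -> Rmin u t < x < Rmax u t -> Io x
}.

(* The integral between the endpoint [F] and [t], oriented from left to right. *)
Definition lim_int (F : (R -> Prop) -> Prop) (s : R) (g : R -> R) (t l : R) : Prop :=
  filterlim (fun u => s * RInt g u t) F (locally l).

Lemma oriented_RInt_ge_0 (J : R -> Prop) (g : R -> R) (s u t : R) :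
  convex_set J -> continuous_in J g -> J u -> J t ->
  s = 1 \/ s = -1 -> 0 < s * (t - u) ->
  (forall x, Rmin u t < x < Rmax u t -> 0 <= g x) -> 0 <= s * RInt g u t.
Proof.
  intros HJ Hg Hu Ht [-> | ->] Hs Hp.
  - rewrite Rmin_left, Rmax_right in Hp by lra. rewrite Rmult_1_l.
    apply RInt_ge_0; [lra | apply (ex_RInt_in J); assumption | exact Hp].
  - rewrite Rmin_right, Rmax_left in Hp by lra.
    rewrite (RInt_swap_in J) by assumption.
    assert (0 <= RInt g t u); [| lra].
    apply RInt_ge_0; [lra | apply (ex_RInt_in J); assumption | exact Hp].
Qed.

Lemma oriented_RInt_gt_0 (J : R -> Prop) (g : R -> R) (s u t : R) :
  convex_set J -> continuous_in J g -> J u -> J t ->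
  s = 1 \/ s = -1 -> 0 < s * (t - u) ->
  (forall x, Rmin u t < x < Rmax u t -> 0 < g x) -> 0 < s * RInt g u t.
Proof.
  intros HJ Hg Hu Ht [-> | ->] Hs Hp.
  - rewrite Rmin_left, Rmax_right in Hp by lra. rewrite Rmult_1_l.
    apply RInt_gt_0; [lra | exact Hp |].
    intros x Hx. apply Hg, (HJ u t); try assumption. rewrite Rmin_left, Rmax_right; lra.
  - rewrite Rmin_right, Rmax_left in Hp by lra.
    rewrite (RInt_swap_in J) by assumption.
    assert (0 < RInt g t u); [| lra].
    apply RInt_gt_0; [lra | exact Hp |].
    intros x Hx. apply Hg, (HJ t u); try assumption. rewrite Rmin_left, Rmax_right; lra.
Qed.

Lemma Rabs_RInt_dominated (J : R -> Prop) (h g : R -> R) (M u t : R) :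
  convex_set J -> continuous_in J h -> continuous_in J g -> J u -> J t ->
  (forall x, Rmin u t < x < Rmax u t -> Rabs (h x) <= M * g x) ->
  Rabs (RInt h u t) <= Rabs (M * RInt g u t).
Proof.
  intros HJ Hh Hg.
  assert (Hha : continuous_in J (fun x => Rabs (h x))).
  { intros x Hx. apply (filterlim_R_abs (locally x)), Hh, Hx. }
  assert (HMg : continuous_in J (fun x => M * g x)).
  { intros x Hx. apply (filterlim_R_scal (locally x)), Hg, Hx. }
  assert (W : forall a b, a <= b -> J a -> J b ->
    (forall x, a < x < b -> Rabs (h x) <= M * g x) ->
    Rabs (RInt h a b) <= Rabs (M * RInt g a b)).
  { intros a b Hab Ha Hb Hd.
    eapply Rle_trans; [apply abs_RInt_le; [exact Hab | apply (ex_RInt_in J); assumption] |].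
    eapply Rle_trans; [| apply Rle_abs].
    rewrite <- (RInt_scal_in J) by assumption.
    apply RInt_le; try assumption; apply (ex_RInt_in J); assumption. }
  intros Hu Ht Hd. destruct (Rle_dec u t) as [L | L].
  - rewrite Rmin_left, Rmax_right in Hd by lra. apply W; assumption.
  - rewrite Rmin_right, Rmax_left in Hd by lra.
    rewrite (RInt_swap_in J h t u), (RInt_swap_in J g t u) by assumption.
    replace (M * - RInt g t u) with (- (M * RInt g t u)) by ring.
    rewrite !Rabs_Ropp. apply W; try assumption. lra.
Qed.

Lemma lim_int_unique (F : (R -> Prop) -> Prop) {FF : ProperFilter F} (s : R) (g : R -> R)
  (t l l' : R) : lim_int F s g t l -> lim_int F s g t l' -> l = l'.
Proof. apply (filterlim_R_unique F). Qed.

(** When [t] is the included endpoint itself, it is still a point of the open set [J]; the primitive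
    is continuous there and vanishes at [t]. *)
Lemma lim_int_at_endpoint (I Io J : R -> Prop) (F : (R -> Prop) -> Prop) {FF : Filter F}
  (s : R) (g : R -> R) (t : R) :
  interval_hull I Io J -> continuous_in J g -> F Io -> I t ->
  filterlim (fun u => u) F (locally t) -> lim_int F s g t 0.
Proof.
  intros [HO HJ HI HIJ HIo Hb] Hg HF Ht Hlim.
  apply filterlim_ext_loc with (fun u => - s * RInt g t u).
  { revert HF. apply filter_imp. intros u Hu.
    rewrite (RInt_swap_in J g u t) by auto. ring. }
  replace 0 with (- s * RInt g t t).
  2:{ rewrite RInt_point. apply Rmult_0_r. }
  apply (filterlim_R_scal F).
  eapply filterlim_comp; [exact Hlim |].
  apply (ex_derive_continuous (K := R_AbsRing) (V := R_NormedModule) (fun u => RInt g t u) t).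
  exists (g t). apply (is_derive_primitive J); auto.
Qed.

Lemma lim_int_ge_0 (I Io J : R -> Prop) (F : (R -> Prop) -> Prop) (s : R) (g : R -> R) (t l : R) :
  interval_hull I Io J -> endpoint_filter I Io F s -> continuous_in J g -> I t ->
  (forall x, Io x -> 0 <= g x) -> lim_int F s g t l -> 0 <= l.
Proof.
  intros HH [FF Hs HF Hby Hcl] Hg Ht Hp Hl.
  destruct (Hcl t Ht) as [A | A].
  - destruct HH as [HO HJ HI HIJ HIo Hb].
    apply (filterlim_R_le F (fun _ => 0) (fun u => s * RInt g u t));
      [| apply filterlim_const | exact Hl].
    generalize (filter_and _ _ HF A). apply filter_imp. intros u [Hu Hut].
    apply (oriented_RInt_ge_0 J); auto. intros x Hx. apply Hp, (Hb u t); assumption.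
  - right. apply (lim_int_unique F s g t); [| exact Hl].
    apply (lim_int_at_endpoint I Io J F); assumption.
Qed.

(** A limit of positive numbers may be 0, so a fixed piece, the integral between some [u0] and [t],
    is kept as a lower bound. Such a [u0] exists because [t] is interior. *)
Lemma lim_int_gt_0 (I Io J : R -> Prop) (F : (R -> Prop) -> Prop) (s : R) (g : R -> R) (t l : R) :
  interval_hull I Io J -> endpoint_filter I Io F s -> continuous_in J g -> Io t ->
  (forall x, Io x -> 0 < g x) -> lim_int F s g t l -> 0 < l.
Proof.
  intros [HO HJ HI HIJ HIo Hb] [FF Hs HF Hby Hcl] Hg Ht Hp Hl.
  destruct (filter_ex (F := F) _ (filter_and _ _ HF (Hby t Ht))) as (u0 & Hu0 & Hu0t).
  assert (P : 0 < s * RInt g u0 t).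
  { apply (oriented_RInt_gt_0 J); auto. intros x Hx. apply Hp, (Hb u0 t); auto. }
  eapply Rlt_le_trans; [exact P |].
  apply (filterlim_R_le F (fun _ => s * RInt g u0 t) (fun u => s * RInt g u t));
    [| apply filterlim_const | exact Hl].
  generalize (filter_and _ _ HF (Hby u0 Hu0)). apply filter_imp. intros u [Hu Huu].
  rewrite (RInt_Chasles_in J g u u0 t) by auto.
  assert (0 <= s * RInt g u u0); [| lra].
  apply (oriented_RInt_ge_0 J); auto. intros x Hx. left. apply Hp, (Hb u u0); auto.
Qed.

(** Comparison test via the Cauchy criterion. It produces the outer integral: with [h] equal to [G]
    times the weight and [M] a bound on [G], the majorant is the second single integral of the
    hypotheses. *)
Lemma lim_int_dominated (I Io J : R -> Prop) (F : (R -> Prop) -> Prop) (s : R) (h g : R -> R)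
  (M t l : R) :
  interval_hull I Io J -> endpoint_filter I Io F s ->
  continuous_in J h -> continuous_in J g -> I t -> 0 <= M ->
  (forall x, Io x -> Rabs (h x) <= M * g x) -> lim_int F s g t l ->
  exists l', lim_int F s h t l' /\ Rabs l' <= M * Rabs l.
Proof.
  intros [HO HJ HI HIJ HIo Hb] [FF Hs HF Hby Hcl] Hh Hg Ht HM Hd Hl.
  assert (Hs1 : Rabs s = 1).
  { destruct Hs as [-> | ->]; [apply Rabs_pos_eq | rewrite Rabs_left]; lra. }
  assert (D : forall u v, Io u -> I v -> Rabs (RInt h u v) <= Rabs (M * RInt g u v)).
  { intros u v Hu Hv. apply (Rabs_RInt_dominated J); auto.
    intros x Hx. apply Hd, (Hb u v); assumption. }
  assert (E : exists l', filterlim (fun u => s * RInt h u t) F (locally l')).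
  { apply (filterlim_locally_cauchy (U := R_CompleteSpace) (F := F)). intros eps.
    assert (He := cond_pos eps).
    set (d := eps / (2 * (M + 1))).
    assert (Hdp : 0 < d) by (apply Rdiv_lt_0_compat; lra).
    exists (fun u => Io u /\ Rabs (s * RInt g u t - l) < d). split.
    { apply filter_and; [exact HF |]. apply (proj1 (filterlim_R_eps F _ _) Hl), Hdp. }
    intros u v [Iu Hu] [Iv Hv].
    change (Rabs (s * RInt h v t - s * RInt h u t) < eps).
    assert (Ch := RInt_Chasles_in J h v u t HJ Hh (HIJ _ (HIo _ Iv)) (HIJ _ (HIo _ Iu)) (HIJ _ Ht)).
    assert (Cg := RInt_Chasles_in J g v u t HJ Hg (HIJ _ (HIo _ Iv)) (HIJ _ (HIo _ Iu)) (HIJ _ Ht)).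
    replace (_ - _) with (s * RInt h v u) by (rewrite Ch; ring).
    rewrite Rabs_mult, Hs1, Rmult_1_l.
    eapply Rle_lt_trans; [apply (D v u Iv (HIo _ Iu)) |].
    rewrite Rabs_mult, (Rabs_pos_eq M HM).
    assert (B : Rabs (RInt g v u) <= 2 * d).
    { replace (Rabs (RInt g v u)) with (Rabs (s * RInt g v u))
        by (rewrite Rabs_mult, Hs1; ring).
      replace (s * RInt g v u) with (s * RInt g v t - s * RInt g u t) by (rewrite Cg; ring).
      apply Rabs_def2 in Hu; apply Rabs_def2 in Hv. apply Rabs_le; lra. }
    apply Rle_lt_trans with (M * (2 * d)).
    - apply Rmult_le_compat_l; lra.
    - assert (M * (2 * d) + 2 * d = eps) by (unfold d; field; lra). lra. }
  destruct E as [l' Hl']. exists l'. split; [exact Hl' |].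
  replace (M * Rabs l) with (Rabs (M * l)) by (rewrite Rabs_mult, (Rabs_pos_eq M HM); reflexivity).
  apply (filterlim_R_le F (fun u => Rabs (s * RInt h u t)) (fun u => Rabs (M * (s * RInt g u t)))).
  - revert HF. apply filter_imp. intros u Hu.
    replace (M * (s * RInt g u t)) with (s * (M * RInt g u t)) by ring.
    rewrite !(Rabs_mult s), Hs1, !Rmult_1_l. apply D; assumption.
  - apply (filterlim_R_abs F), Hl'.
  - apply (filterlim_R_abs F), (filterlim_R_scal F), Hl.
Qed.

(** The product [exp (A t) * Gam t] is an integral whose integrand is independent of [t], hence
    equals its value at [t0] plus an ordinary integral from [t0] to [t]. That formula makes sense on
    all of [J], even beyond an included endpoint, and so yields a continuous extension of [Gam] fit
    to be integrated again. *)
Lemma lim_int_continuous (I Io J : R -> Prop) (t0 : R) (F : (R -> Prop) -> Prop) (s : R)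
  (A m Gam : R -> R) :
  interval_hull I Io J -> endpoint_filter I Io F s ->
  continuous_in J A -> continuous_in J m -> I t0 ->
  (forall t, I t -> lim_int F s (fun x => exp (A x - A t) * m x) t (Gam t)) ->
  exists G, continuous_in J G /\ forall t, I t -> G t = Gam t.
Proof.
  intros [HO HJ HI HIJ HIo Hb] [FF Hs HF Hby Hcl] HA Hm H0 HG.
  set (g := fun x => exp (A x) * m x).
  assert (Hg : continuous_in J g).
  { intros x Hx. apply (filterlim_R_mult (locally x)); [| apply Hm, Hx].
    apply (filterlim_R_exp (locally x)), HA, Hx. }
  assert (Hk : forall t u v, J u -> J v ->
             RInt (fun x => exp (A x - A t) * m x) u v = exp (- A t) * RInt g u v).
  { intros t u v Hu Hv. rewrite <- (RInt_scal_in J) by assumption.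
    apply RInt_ext. intros x _. unfold g.
    rewrite <- Rmult_assoc, <- exp_plus. do 2 f_equal. ring. }
  exists (fun t => exp (- A t) * (exp (A t0) * Gam t0 + s * RInt g t0 t)). split.
  - intros t Ht. apply (filterlim_R_mult (locally t)).
    + apply (filterlim_R_exp (locally t)).
      apply (filterlim_comp _ _ _ A Ropp _ _ _ (HA t Ht)).
      apply (filterlim_opp (V := R_NormedModule)).
    + apply (filterlim_R_plus (locally t)); [apply filterlim_const |].
      apply (filterlim_R_scal (locally t)).
      apply (ex_derive_continuous (K := R_AbsRing) (V := R_NormedModule) (fun u => RInt g t0 u) t).
      exists (g t). apply (is_derive_primitive J); auto.
  - intros t Ht.
    refine (lim_int_unique F s _ t _ _ _ (HG t Ht)).
    apply filterlim_ext_loc with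
      (fun u => exp (- A t) * (exp (A t0) * (s * RInt (fun x => exp (A x - A t0) * m x) u t0)
                  + s * RInt g t0 t)).
    + revert HF. apply filter_imp. intros u Hu.
      rewrite !Hk by auto. rewrite (RInt_Chasles_in J g u t0 t) by auto.
      transitivity (exp (- A t) * ((exp (A t0) * exp (- A t0)) * (s * RInt g u t0) + s * RInt g t0 t));
        [ring |].
      rewrite <- exp_plus, Rplus_opp_r, exp_0. ring.
    + apply (filterlim_R_scal F), (filterlim_R_plus F); [| apply filterlim_const].
      apply (filterlim_R_scal F), HG, H0.
Qed.

(** All the analysis common to the three cases, with the endpoint filters and orientation signs as
    parameters. Here [q] and [rho] are independent coefficients; the relation between them enters
    only through the Riccati equation later. *)
Lemma two_stage_bound (I Io J : R -> Prop) (t0 : R)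
  (F1 F2 : (R -> Prop) -> Prop) (s1 s2 : R)
  {n : nat} (N : vec n -> R) (HN : is_norm N)
  (alpha q Q rho P : R -> C) (Gam1 Gam2 : R -> R) (M1 M2 : R) :
  interval_hull I Io J -> Io t0 ->
  endpoint_filter I Io F1 s1 -> endpoint_filter I Io F2 s2 ->
  Ccontinuous_in J alpha -> (forall t, J t -> alpha t <> RtoC 0) ->
  (forall t, J t -> Cderive Q t (q t)) -> (forall t, J t -> Cderive P t (rho t)) ->
  (forall t, I t ->
     lim_int F1 s1 (fun x => exp (Re (Q x) - Re (Q t)) / Cmod (alpha x)) t (Gam1 t)) ->
  (forall t, I t -> Gam1 t <= M1) ->
  (forall t, I t -> lim_int F2 s2 (fun x => exp (Re (P t) - Re (P x))) t (Gam2 t)) ->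
  (forall t, I t -> Gam2 t <= M2) ->
  exists (G H : R -> R) (L : R),
    continuous_in J G /\ (forall t, I t -> G t = Gam1 t) /\
    (forall t, I t -> lim_int F2 s2 (fun x => G x * exp (Re (P t) - Re (P x))) t (H t)) /\
    is_lub (fun y => exists t, I t /\ y = H t) L /\ 0 < L /\
    forall (eps : R) (p : R -> vec n), 0 < eps ->
      (forall i, Ccontinuous_in J (fun s => p s i)) -> (forall s, I s -> N (p s) <= eps) ->
      exists z w : R -> vec n,
        (forall t i, J t -> Cderive (fun s => z s i) t (Cplus (Cmult (rho t) (z t i)) (w t i))) /\
        (forall t i, J t -> Cderive (fun s => w s i) t
           (Cminus (Cdiv (p t i) (alpha t)) (Cmult (q t) (w t i)))) /\
        (forall t, I t -> N (z t) <= L * eps).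
Proof.
  intros HH H0 E1 E2 Ha Hanz HQ HP HG1 HM1 HG2 HM2.
  pose proof HH as [HO HJ HI HIJ HIo Hb].
  assert (I0 : I t0) by auto.
  assert (HcQ : continuous_in J (fun s => Re (Q s))).
  { apply (Ccontinuous_in_components J Q). intros t Ht. eapply Cderive_continuous, HQ, Ht. }
  assert (HcP : continuous_in J (fun s => Re (P s))).
  { apply (Ccontinuous_in_components J P). intros t Ht. eapply Cderive_continuous, HP, Ht. }
  assert (Hap : forall t, J t -> 0 < Cmod (alpha t)) by (intros t Ht; apply Cmod_gt_0; auto).
  assert (Hca : continuous_in J (fun s => / Cmod (alpha s))).
  { intros t Ht. apply (filterlim_R_inv (locally t)).
    - specialize (Hap t Ht). lra.
    - apply (filterlim_Cmod (locally t)), Ha, Ht. }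
  assert (Hc1 : forall t, continuous_in J (fun x => exp (Re (Q x) - Re (Q t)) / Cmod (alpha x))).
  { intros t x Hx. apply (filterlim_R_mult (locally x)); [| apply Hca, Hx].
    apply (filterlim_R_exp (locally x)), (filterlim_R_minus (locally x));
      [apply HcQ, Hx | apply filterlim_const]. }
  assert (Hc2 : forall t, continuous_in J (fun x => exp (Re (P t) - Re (P x)))).
  { intros t x Hx.
    apply (filterlim_R_exp (locally x)), (filterlim_R_minus (locally x));
      [apply filterlim_const | apply HcP, Hx]. }
  assert (Hp1 : forall t x, J x -> 0 < exp (Re (Q x) - Re (Q t)) / Cmod (alpha x)).
  { intros t x Hx. apply Rdiv_lt_0_compat; [apply exp_pos | apply Hap, Hx]. }
  destruct (lim_int_continuous I Io J t0 F1 s1 (fun s => Re (Q s)) (fun s => / Cmod (alpha s)) Gam1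
              HH E1 HcQ Hca I0 HG1) as (G & HGc & HGe).
  assert (G0 : forall t, I t -> 0 <= G t).
  { intros t Ht. rewrite (HGe t Ht).
    apply (lim_int_ge_0 I Io J F1 s1 _ t _ HH E1 (Hc1 t) Ht); [| apply HG1, Ht].
    intros x Hx. left. apply Hp1; auto. }
  assert (Gp : forall t, Io t -> 0 < G t).
  { intros t Ht. rewrite (HGe t (HIo t Ht)).
    apply (lim_int_gt_0 I Io J F1 s1 _ t _ HH E1 (Hc1 t) Ht); [| apply HG1; auto].
    intros x Hx. apply Hp1; auto. }
  assert (GM : forall t, I t -> G t <= M1) by (intros t Ht; rewrite HGe; auto).
  assert (M1p : 0 <= M1) by (eapply Rle_trans; [apply (G0 t0 I0) | apply GM, I0]).
  assert (Hc3 : forall t, continuous_in J (fun x => G x * exp (Re (P t) - Re (P x)))).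
  { intros t x Hx. apply (filterlim_R_mult (locally x)); [apply HGc, Hx | apply Hc2, Hx]. }
  (* The condition [I t] is placed under the existential so that choice gives a total function [H];
     off [I] the value is an arbitrary 0. *)
  assert (HHex : forall t, exists y, I t ->
            lim_int F2 s2 (fun x => G x * exp (Re (P t) - Re (P x))) t y /\
            Rabs y <= M1 * Rabs (Gam2 t)).
  { intros t. destruct (classic (I t)) as [Ht | Ht]; [| exists 0; tauto].
    destruct (lim_int_dominated I Io J F2 s2 _ _ M1 t (Gam2 t) HH E2 (Hc3 t) (Hc2 t) Ht M1p)
      as (y & Hy).
    - intros x Hx. rewrite Rabs_mult, (Rabs_pos_eq (exp _)) by (left; apply exp_pos).
      apply Rmult_le_compat_r; [left; apply exp_pos |].
      rewrite Rabs_pos_eq by (left; apply Gp, Hx). apply GM; auto.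
    - apply HG2, Ht.
    - exists y. intros _. exact Hy. }
  destruct (functional_choice _ HHex) as [H HHl].
  assert (G20 : forall t, I t -> 0 <= Gam2 t).
  { intros t Ht. apply (lim_int_ge_0 I Io J F2 s2 _ t _ HH E2 (Hc2 t) Ht); [| apply HG2, Ht].
    intros x Hx. left. apply exp_pos. }
  assert (HB : forall t, I t -> H t <= M1 * M2).
  { intros t Ht. destruct (HHl t Ht) as [_ B].
    eapply Rle_trans; [apply Rle_abs |]. eapply Rle_trans; [exact B |].
    rewrite Rabs_pos_eq by (apply G20, Ht). apply Rmult_le_compat_l; auto. }
  assert (Hge : forall t, I t -> 0 <= H t).
  { intros t Ht. apply (lim_int_ge_0 I Io J F2 s2 _ t _ HH E2 (Hc3 t) Ht); [| apply HHl, Ht].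
    intros x Hx. apply Rmult_le_pos; [apply G0; auto | left; apply exp_pos]. }
  assert (Hgt : 0 < H t0).
  { apply (lim_int_gt_0 I Io J F2 s2 _ t0 _ HH E2 (Hc3 t0) H0); [| apply HHl, I0].
    intros x Hx. apply Rmult_lt_0_compat; [apply Gp, Hx | apply exp_pos]. }
  destruct (completeness (fun y => exists t, I t /\ y = H t)) as [L HL].
  { exists (M1 * M2). intros y (t & Ht & ->). apply HB, Ht. }
  { exists (H t0), t0. split; [exact I0 | reflexivity]. }
  assert (HLb : forall t, I t -> H t <= L).
  { intros t Ht. apply HL. exists t. split; [exact Ht | reflexivity]. }
  exists G, H, L. repeat split; try assumption; try apply HL.
  - intros t Ht. apply HHl, Ht.
  - eapply Rlt_le_trans; [exact Hgt | apply HLb, I0].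
  - intros eps p He Hpc Hpb.
    pose proof E1 as [FF1 Hs1 HF1 _ _]. pose proof E2 as [FF2 Hs2 HF2 _ _].
    assert (Sq1 : s1 * s1 = 1) by (destruct Hs1 as [-> | ->]; ring).
    assert (Sq2 : s2 * s2 = 1) by (destruct Hs2 as [-> | ->]; ring).
    assert (FI1 : F1 I) by (revert HF1; apply filter_imp, HIo).
    assert (FI2 : F2 I) by (revert HF2; apply filter_imp, HIo).
    (* First equation: the majorant of [p / alpha] is [eps / Cmod alpha], whose weighted integral is
       [eps] times [Gam1]. The factor [s1] undoes the orientation built into [lim_int], since
       [s1 * s1 = 1]. *)
    destruct (first_order_bounded_solution I J t0 F1 N HN q Q
                (fun s i => Cdiv (p s i) (alpha s)) (fun s => eps * / Cmod (alpha s))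
                (fun t => eps * (s1 * Gam1 t))) as (w & Hw1 & Hw2); try assumption.
    { intros i t Ht.
      apply (filterlim_Cdiv (locally t)); [apply Hanz, Ht | apply Hpc, Ht | apply Ha, Ht]. }
    { intros t Ht. apply (filterlim_R_scal (locally t)), Hca, Ht. }
    { intros t Ht.
      replace (fun i => Cdiv (p t i) (alpha t)) with (vscal (Cinv (alpha t)) (p t)).
      2:{ extensionality i. unfold vscal, Cdiv. ring. }
      rewrite (vnorm_scal N HN), Cmod_inv by auto. rewrite Rmult_comm.
      apply Rmult_le_compat_r; [| apply Hpb, Ht].
      left. apply Rinv_0_lt_compat, Hap; auto. }
    { intros t Ht. apply filterlim_ext_loc with
        (fun u => eps * (s1 * (s1 * RInt (fun x => exp (Re (Q x) - Re (Q t)) / Cmod (alpha x)) u t))).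
      2:{ apply (filterlim_R_scal F1), (filterlim_R_scal F1), HG1, Ht. }
      revert FI1. apply filter_imp. intros u Hu.
      rewrite <- (Rmult_assoc s1), Sq1, Rmult_1_l.
      rewrite <- (RInt_scal_in J) by auto.
      apply RInt_ext_R. intros x _. unfold Rdiv. ring. }
    assert (Hcw : forall i, Ccontinuous_in J (fun s => w s i)).
    { intros i t Ht. eapply Cderive_continuous, Hw1, Ht. }
    (* Second equation, [z' = rho z + w]: the same lemma with [q] replaced by [- rho]. The bound
       [eps * G] just obtained for [w] becomes the majorant, so its integral is [eps * H]. *)
    destruct (first_order_bounded_solution I J t0 F2 N HN (fun t => Copp (rho t)) (fun t => Copp (P t))
                w (fun s => eps * Rabs (G s)) (fun t => eps * (s2 * H t))) as (z & Hz1 & Hz2);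
      try assumption.
    { intros t Ht. apply Cderive_opp, HP, Ht. }
    { intros t Ht. apply (filterlim_R_scal (locally t)), (filterlim_R_abs (locally t)), HGc, Ht. }
    { intros t Ht. eapply Rle_trans; [apply Hw2, Ht |]. right.
      rewrite !Rabs_mult, (Rabs_pos_eq eps), (HGe t Ht) by lra.
      replace (Rabs s1) with 1; [ring |].
      destruct Hs1 as [-> | ->]; [rewrite Rabs_pos_eq | rewrite Rabs_left]; lra. }
    { intros t Ht. apply filterlim_ext_loc with
        (fun u => eps * (s2 * (s2 * RInt (fun x => G x * exp (Re (P t) - Re (P x))) u t))).
      2:{ apply (filterlim_R_scal F2), (filterlim_R_scal F2), HHl, Ht. }
      revert HF2. apply filter_imp. intros u Hu.
      rewrite <- (Rmult_assoc s2), Sq2, Rmult_1_l.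
      rewrite <- (RInt_scal_in J) by auto.
      apply RInt_ext_R. intros x Hx.
      rewrite (Rabs_pos_eq (G x)) by (left; apply Gp, (Hb u t); assumption).
      replace (Re (Copp (P x)) - Re (Copp (P t))) with (Re (P t) - Re (P x)); [ring |].
      unfold Copp, Re; simpl. ring. }
    exists z, w. split; [| split].
    + intros t i Ht. eapply Cderive_eq; [| apply Hz1, Ht]. ring.
    + exact Hw1.
    + intros t Ht. eapply Rle_trans; [apply Hz2, Ht |].
      rewrite !Rabs_mult, (Rabs_pos_eq eps), (Rabs_pos_eq (H t)) by (try lra; auto).
      replace (Rabs s2) with 1.
      * rewrite Rmult_1_l, Rmult_comm. apply Rmult_le_compat_r; [lra | apply HLb, Ht].
      * destruct Hs2 as [-> | ->]; [rewrite Rabs_pos_eq | rewrite Rabs_left]; lra.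
Qed.

(** * Derivatives relative to an interval *)

Lemma filterlim_within_weaken {T U : Type} (D : T -> Prop) (F : (T -> Prop) -> Prop) {FF : Filter F}
  (G : (U -> Prop) -> Prop) (f : T -> U) :
  filterlim f F G -> filterlim f (within D F) G.
Proof. apply filterlim_filter_le_1, filter_le_within. Qed.

(** Write [g s] as [g t] plus [s - t] times the difference quotient and let [s] tend to [t] within
    [I]. *)
Lemma cderiv_on_ccont_on (I : R -> Prop) (g g' : R -> C) : cderiv_on I g g' -> ccont_on I g.
Proof.
  intros H t Ht.
  assert (A : filterlim g (within (fun s => I s /\ s <> t) (locally t)) (locally (g t))).
  { apply filterlim_within_ext with
      (fun s => Cplus (g t) (Cmult (RtoC (s - t))
                  (Cmult (RtoC (/ (s - t))) (Cminus (g s) (g t))))).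
    - intros s [_ Hs]. rewrite Cmult_assoc, <- RtoC_mult, Rinv_r by lra. ring.
    - assert (E : Cplus (g t) (Cmult (RtoC (t - t)) (g' t)) = g t)
        by (rewrite Rminus_diag; ring).
      refine (eq_rect _ (fun l => filterlim _ _ (locally l)) _ _ E).
      apply filterlim_Cplus; [typeclasses eauto | apply filterlim_const |].
      apply filterlim_Cmult; [typeclasses eauto | | exact (H t Ht)].
      apply filterlim_within_weaken; [typeclasses eauto |].
      apply (filterlim_C (locally t)). split; simpl; [| apply filterlim_const].
      apply (filterlim_R_minus (locally t)); [apply filterlim_id | apply filterlim_const]. }
  (* The limit so far excludes [s = t], which [ccont_on] includes; there [g s] is the limit
     itself. *)
  intros P HP. assert (B := A P HP). unfold filtermap, within in *.
  revert B. apply filter_imp. intros s Hs Is.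
  destruct (Req_dec s t) as [-> | Hst]; [exact (locally_singleton _ _ HP) | auto].
Qed.

Lemma cderiv_on_plus (I : R -> Prop) (f g f' g' : R -> C) :
  cderiv_on I f f' -> cderiv_on I g g' ->
  cderiv_on I (fun t => Cplus (f t) (g t)) (fun t => Cplus (f' t) (g' t)).
Proof.
  intros Hf Hg t Ht.
  eapply filterlim_ext; [| apply (filterlim_Cplus _ _ _ _ _ (Hf t Ht) (Hg t Ht))].
  intros s. cbv beta. ring.
Qed.

Lemma cderiv_on_minus (I : R -> Prop) (f g f' g' : R -> C) :
  cderiv_on I f f' -> cderiv_on I g g' ->
  cderiv_on I (fun t => Cminus (f t) (g t)) (fun t => Cminus (f' t) (g' t)).
Proof.
  intros Hf Hg t Ht.
  eapply filterlim_ext; [| apply (filterlim_Cminus _ _ _ _ _ (Hf t Ht) (Hg t Ht))].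
  intros s. cbv beta. ring.
Qed.

(** The increment of the product is split as [(f s - f t) * g s + f t * (g s - g t)], hence the use
    of continuity of [g]. *)
Lemma cderiv_on_mult (I : R -> Prop) (f g f' g' : R -> C) :
  ccont_on I g -> cderiv_on I f f' -> cderiv_on I g g' ->
  cderiv_on I (fun t => Cmult (f t) (g t))
    (fun t => Cplus (Cmult (f' t) (g t)) (Cmult (f t) (g' t))).
Proof.
  intros Hc Hf Hg t Ht.
  assert (Hc' : filterlim g (within (fun s => I s /\ s <> t) (locally t)) (locally (g t))).
  { refine (filterlim_filter_le_1 g _ (Hc t Ht)). unfold filter_le, within.
    intros P. apply filter_imp. intros x Hx [A _]. apply Hx, A. }
  eapply filterlim_ext.
  2:{ apply filterlim_Cplus; [typeclasses eauto | |].
      - apply filterlim_Cmult; [typeclasses eauto | exact (Hf t Ht) | exact Hc'].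
      - apply filterlim_Cmult; [typeclasses eauto | apply (filterlim_const (f t)) | exact (Hg t Ht)]. }
  intros s. cbv beta. ring.
Qed.

Lemma filterlim_difference_quotient (g : R -> R) (t l : R) (D : R -> Prop) :
  is_derive g t l ->
  filterlim (fun s => / (s - t) * (g s - g t)) (within (fun s => D s /\ s <> t) (locally t))
            (locally l).
Proof.
  intros H. apply is_derive_Reals in H.
  apply filterlim_R_eps; [typeclasses eauto |]. intros eps He.
  destruct (H eps He) as [d Hd]. exists d. intros s Hs [_ Hst].
  assert (A : s - t <> 0) by lra.
  assert (B := Hd (s - t) A Hs).
  change (Rabs ((g (t + (s - t)) - g t) / (s - t) - l) < eps) in B.
  rewrite (Rplus_minus t s) in B. rewrite Rmult_comm. exact B.
Qed.

(** Passage from two-sided derivatives, obtained on the open hull, to the relative derivatives of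
    the stability definition, included endpoints being covered as well. *)
Lemma cderiv_on_Cderive (I : R -> Prop) (g g' : R -> C) :
  (forall t, I t -> Cderive g t (g' t)) -> cderiv_on I g g'.
Proof.
  intros H t Ht. destruct (H t Ht) as [H1 H2].
  apply filterlim_C; [typeclasses eauto |]. split.
  - eapply filterlim_ext; [| apply (filterlim_difference_quotient _ _ _ I H1)].
    intros s. unfold Cmult, Cminus, Cplus, Copp, RtoC, Re, Im; simpl.
    match goal with |- ?a = ?b => change (@eq R a b) end. ring.
  - eapply filterlim_ext; [| apply (filterlim_difference_quotient _ _ _ I H2)].
    intros s. unfold Cmult, Cminus, Cplus, Copp, RtoC, Re, Im; simpl.
    match goal with |- ?a = ?b => change (@eq R a b) end. ring.
Qed.

(** * The interval [Iset] and its endpoints *)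

Definition left_of (tau : Rbar) (b : bool) (t : R) : Prop :=
  Rbar_lt tau t \/ (b = true /\ tau = Finite t).

Definition right_of (sigma : Rbar) (b : bool) (t : R) : Prop :=
  Rbar_lt t sigma \/ (b = true /\ sigma = Finite t).

Lemma left_of_lt (tau : Rbar) (b : bool) (t x : R) :
  left_of tau b t -> t < x -> Rbar_lt tau x.
Proof.
  intros [H | [_ ->]] Hx; [| exact Hx]. eapply Rbar_lt_trans; [exact H | exact Hx].
Qed.

Lemma left_of_le (tau : Rbar) (b : bool) (t x : R) :
  left_of tau b t -> t <= x -> left_of tau b x.
Proof.
  intros H [Hx | <-]; [left; eapply left_of_lt; eassumption | exact H].
Qed.

Lemma right_of_lt (sigma : Rbar) (b : bool) (t x : R) :
  right_of sigma b t -> x < t -> Rbar_lt x sigma.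
Proof.
  intros [H | [_ ->]] Hx; [| exact Hx]. eapply Rbar_lt_trans; [| exact H]. exact Hx.
Qed.

Lemma right_of_le (sigma : Rbar) (b : bool) (t x : R) :
  right_of sigma b t -> x <= t -> right_of sigma b x.
Proof.
  intros H [Hx | ->]; [left; eapply right_of_lt; eassumption | exact H].
Qed.

Definition Iinterior (tau sigma : Rbar) (t : R) : Prop := Rbar_lt tau t /\ Rbar_lt t sigma.

(** The constraint at an included endpoint is dropped altogether, so that such an endpoint becomes
    an interior point; an excluded endpoint stays outside, and there the integrals may be genuinely
    improper. *)
Definition Ihull (tau sigma : Rbar) (btau bsigma : bool) (t : R) : Prop :=
  (btau = true \/ Rbar_lt tau t) /\ (bsigma = true \/ Rbar_lt t sigma).

Lemma Iset_hull (tau sigma : Rbar) (btau bsigma : bool) :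
  interval_hull (Iset tau sigma btau bsigma) (Iinterior tau sigma) (Ihull tau sigma btau bsigma).
Proof.
  constructor.
  - apply open_and.
    + destruct btau.
      * eapply open_ext; [| apply open_true]. simpl. tauto.
      * eapply open_ext; [| apply (open_Rbar_gt tau)]. simpl. intuition congruence.
    + destruct bsigma.
      * eapply open_ext; [| apply open_true]. simpl. tauto.
      * eapply open_ext; [| apply (open_Rbar_lt sigma)]. simpl. intuition congruence.
  - intros a b x [A1 A2] [B1 B2] [X1 X2]. split.
    + destruct A1 as [A1 | A1]; [left; exact A1 |].
      destruct B1 as [B1 | B1]; [left; exact B1 | right].
      apply Rbar_lt_le_trans with (Rmin a b); [| exact X1].
      unfold Rmin; destruct (Rle_dec a b); assumption.
    + destruct A2 as [A2 | A2]; [left; exact A2 |].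
      destruct B2 as [B2 | B2]; [left; exact B2 | right].
      apply Rbar_le_lt_trans with (Rmax a b); [exact X2 |].
      unfold Rmax; destruct (Rle_dec a b); assumption.
  - intros a b x [A1 A2] [B1 B2] [X1 X2]. split.
    + apply (left_of_le tau btau (Rmin a b)); [| exact X1].
      unfold Rmin; destruct (Rle_dec a b); assumption.
    + apply (right_of_le sigma bsigma (Rmax a b)); [| exact X2].
      unfold Rmax; destruct (Rle_dec a b); assumption.
  - intros t [A B]. split; [destruct A | destruct B]; tauto.
  - intros t [A B]. split; left; assumption.
  - intros u t x [A1 A2] [B1 B2] [X1 X2]. split.
    + apply (left_of_lt tau btau (Rmin u t)); [| exact X1].
      unfold Rmin; destruct (Rle_dec u t); [left; exact A1 | exact B1].
    + apply (right_of_lt sigma bsigma (Rmax u t)); [| exact X2].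
      unfold Rmax; destruct (Rle_dec u t); [exact B2 | left; exact A2].
Qed.

Lemma Rbar_locally'_gt (tau sigma : Rbar) :
  Rbar_lt tau sigma -> Rbar_locally' sigma (fun u => Rbar_lt tau u).
Proof.
  destruct sigma as [r | |]; intros H; simpl.
  - apply filter_le_within. exact (open_Rbar_gt tau r H).
  - destruct tau as [r | |]; simpl in *; [exists r; trivial | contradiction | exists 0; trivial].
  - destruct tau; contradiction.
Qed.

Lemma Rbar_locally'_lt (tau sigma : Rbar) :
  Rbar_lt tau sigma -> Rbar_locally' tau (fun u => Rbar_lt u sigma).
Proof.
  destruct tau as [r | |]; intros H; simpl.
  - apply filter_le_within. exact (open_Rbar_lt sigma r H).
  - destruct sigma; contradiction.
  - destruct sigma as [r | |]; simpl in *; [exists r; trivial | exists 0; trivial | contradiction].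
Qed.

Lemma to_sigma_endpoint (tau sigma : Rbar) (btau bsigma : bool) :
  Rbar_lt tau sigma ->
  endpoint_filter (Iset tau sigma btau bsigma) (Iinterior tau sigma) (to_sigma sigma) (-1).
Proof.
  intros H.
  assert (FF : Filter (to_sigma sigma)).
  { exact (within_filter R _ (Rbar_locally' sigma) _). }
  assert (W : forall x, Rbar_lt x sigma -> to_sigma sigma (fun u => Rbar_lt x u)).
  { intros x Hx. apply filter_le_within. apply Rbar_locally'_gt, Hx. }
  constructor.
  - constructor; [| exact FF]. intros P HP. unfold to_sigma, within in HP.
    destruct sigma as [r | |].
    + destruct HP as [e He]. exists (r - e / 2).
      assert (E := cond_pos e).
      apply He; [| lra | simpl; lra].
      change (Rabs (r - e / 2 - r) < e). apply Rabs_def1; lra.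
    + destruct HP as [M HM]. exists (M + 1). apply HM; [lra | exact Logic.I].
    + destruct tau; contradiction.
  - right; reflexivity.
  - apply filter_and; [apply W, H |].
    unfold to_sigma, within. apply filter_forall. trivial.
  - intros t [_ Ht]. generalize (W t Ht). apply filter_imp. simpl. intros u Hu. lra.
  - intros t [_ [Ht | [_ Ht]]].
    + left. generalize (W t Ht). apply filter_imp. simpl. intros u Hu. lra.
    + right. subst sigma. intros P HP. unfold filtermap, to_sigma. simpl.
      (* One restriction is the one-sidedness of [to_sigma], the other the puncture in
         [Rbar_locally']. *)
      apply filter_le_within. apply filter_le_within. exact HP.
Qed.

Lemma to_tau_endpoint (tau sigma : Rbar) (btau bsigma : bool) :
  Rbar_lt tau sigma ->
  endpoint_filter (Iset tau sigma btau bsigma) (Iinterior tau sigma) (to_tau tau) 1.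
Proof.
  intros H.
  assert (FF : Filter (to_tau tau)).
  { exact (within_filter R _ (Rbar_locally' tau) _). }
  assert (W : forall x, Rbar_lt tau x -> to_tau tau (fun u => Rbar_lt u x)).
  { intros x Hx. apply filter_le_within. apply Rbar_locally'_lt, Hx. }
  constructor.
  - constructor; [| exact FF]. intros P HP. unfold to_tau, within in HP.
    destruct tau as [r | |].
    + destruct HP as [e He]. exists (r + e / 2).
      assert (E := cond_pos e).
      apply He; [| lra | simpl; lra].
      change (Rabs (r + e / 2 - r) < e). apply Rabs_def1; lra.
    + destruct sigma; contradiction.
    + destruct HP as [M HM]. exists (M - 1). apply HM; [lra | exact Logic.I].
  - left; reflexivity.
  - apply filter_and; [| apply W, H].
    unfold to_tau, within. apply filter_forall. trivial.
  - intros t [Ht _]. generalize (W t Ht). apply filter_imp. simpl. intros u Hu. lra.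
  - intros t [[Ht | [_ Ht]] _].
    + left. generalize (W t Ht). apply filter_imp. simpl. intros u Hu. lra.
    + right. subst tau. intros P HP. unfold filtermap, to_tau. simpl.
      apply filter_le_within. apply filter_le_within. exact HP.
Qed.

(** The filter at the left endpoint is proper and contains the interior, which settles the finite
    and infinite cases together. *)
Lemma Iinterior_inhabited (tau sigma : Rbar) :
  Rbar_lt tau sigma -> exists t, Iinterior tau sigma t.
Proof.
  intros H. destruct (to_tau_endpoint tau sigma false false H) as [FF _ HF _ _].
  exact (filter_ex (F := to_tau tau) _ HF).
Qed.

(* Composing with [clamp] extends a function on [I] to the open hull, constantly beyond an
   included endpoint, so that only two-sided limits and derivatives have to be handled. *)
Definition clamp (tau sigma : Rbar) (btau bsigma : bool) (t : R) : R :=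
  let t1 := if btau then Rmax (real tau) t else t in
  if bsigma then Rmin (real sigma) t1 else t1.

(** [real] sends an infinite endpoint to 0, so the finiteness of included endpoints is what makes
    the bounds in [clamp] the true ones. *)
Lemma clamp_id (tau sigma : Rbar) (btau bsigma : bool) (t : R) :
  (btau = true -> is_finite tau) -> (bsigma = true -> is_finite sigma) ->
  Iset tau sigma btau bsigma t -> clamp tau sigma btau bsigma t = t.
Proof.
  intros Hbt Hbs [Ht1 Ht2]. unfold clamp.
  replace (if btau then Rmax (real tau) t else t) with t.
  - destruct bsigma; [| reflexivity]. specialize (Hbs eq_refl). rewrite <- Hbs in Ht2.
    apply Rmin_right. destruct Ht2 as [h | [_ h]]; [simpl in h; lra | injection h; lra].
  - destruct btau; [| reflexivity]. specialize (Hbt eq_refl). rewrite <- Hbt in Ht1.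
    symmetry. apply Rmax_right. destruct Ht1 as [h | [_ h]]; [simpl in h; lra | injection h; lra].
Qed.

Lemma clamp_in (tau sigma : Rbar) (btau bsigma : bool) (t : R) :
  Rbar_lt tau sigma -> (btau = true -> is_finite tau) -> (bsigma = true -> is_finite sigma) ->
  Ihull tau sigma btau bsigma t -> Iset tau sigma btau bsigma (clamp tau sigma btau bsigma t).
Proof.
  intros H Hbt Hbs [H1 H2].
  set (t1 := if btau then Rmax (real tau) t else t).
  assert (L1 : left_of tau btau t1).
  { unfold t1. destruct btau.
    - rewrite <- (Hbt eq_refl). simpl. unfold Rmax. destruct (Rle_dec (real tau) t) as [h | h].
      + destruct h as [h | h]; [left; exact h | right; rewrite h; auto].
      + right; auto.
    - left. destruct H1; [discriminate | assumption]. }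
  assert (R1 : bsigma = true \/ Rbar_lt t1 sigma).
  { destruct H2 as [H2 | H2]; [left; exact H2 | right].
    unfold t1. destruct btau; [| exact H2]. rewrite <- (Hbt eq_refl) in H.
    unfold Rmax. destruct (Rle_dec (real tau) t); assumption. }
  unfold clamp. fold t1. clearbody t1. destruct bsigma.
  - rewrite <- (Hbs eq_refl) in H |- *. simpl. unfold Rmin.
    destruct (Rle_dec (real sigma) t1) as [h | h]; split.
    + left. exact H.
    + right. auto.
    + exact L1.
    + left. simpl. lra.
  - split; [exact L1 | left]. destruct R1; [discriminate | assumption].
Qed.

Lemma clamp_lipschitz (tau sigma : Rbar) (btau bsigma : bool) (x y : R) :
  Rabs (clamp tau sigma btau bsigma x - clamp tau sigma btau bsigma y) <= Rabs (x - y).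
Proof.
  unfold clamp, Rmin, Rmax.
  destruct btau, bsigma; cbv zeta; repeat destruct Rle_dec; unfold Rabs; repeat destruct Rcase_abs; lra.
Qed.

(** [clamp] is 1-Lipschitz and maps the hull into the interval, so a two-sided neighbourhood in the
    hull lands in a relative neighbourhood, where [ccont_on] applies. *)
Lemma clamp_extension (tau sigma : Rbar) (btau bsigma : bool) (g : R -> C) :
  Rbar_lt tau sigma -> (btau = true -> is_finite tau) -> (bsigma = true -> is_finite sigma) ->
  ccont_on (Iset tau sigma btau bsigma) g ->
  Ccontinuous_in (Ihull tau sigma btau bsigma) (fun t => g (clamp tau sigma btau bsigma t)).
Proof.
  intros H Hbt Hbs Hg t Ht.
  eapply filterlim_comp; [| apply Hg, clamp_in; assumption].
  intros P [e He]. unfold filtermap.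
  assert (B : locally t (fun x => Rabs (x - t) < e)) by (exists e; intros y Hy; exact Hy).
  generalize (filter_and _ _ B (hull_open _ _ _ (Iset_hull tau sigma btau bsigma) t Ht)).
  apply filter_imp. intros x [Hx Jx]. apply He; [| apply clamp_in; assumption].
  apply Rle_lt_trans with (2 := Hx). apply clamp_lipschitz.
Qed.

(** * Improper integrals as limits *)

(** [is_RInt_gen] is a limit of a relation along a product filter. Since [at_point t] fixes one
    bound and integrals exist eventually, it becomes a limit of the function [RInt]. *)
Lemma is_RInt_gen_at_point_l (f : R -> R) (F : (R -> Prop) -> Prop) {FF : Filter F} (t l : R) :
  F (fun u => ex_RInt f t u) ->
  (is_RInt_gen f (at_point t) F l <-> filterlim (fun u => RInt f t u) F (locally l)).
Proof.
  intros Hex. split.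
  - intros H P HP. destruct (H P HP) as [Q R HQ HR HQR]. unfold filtermap.
    revert HR. apply filter_imp. intros u Hu.
    destruct (HQR t u HQ Hu) as (y & Hy & HPy). simpl in Hy.
    rewrite (is_RInt_unique _ _ _ _ Hy). exact HPy.
  - intros H P HP.
    apply Filter_prod with (fun x => x = t) (fun u => ex_RInt f t u /\ P (RInt f t u)).
    + reflexivity.
    + apply filter_and; [exact Hex | exact (H P HP)].
    + intros x u -> [Hu HPu]. exists (RInt f t u). split; [| exact HPu].
      apply (RInt_correct f), Hu.
Qed.

Lemma is_RInt_gen_at_point_r (f : R -> R) (F : (R -> Prop) -> Prop) {FF : Filter F} (t l : R) :
  F (fun u => ex_RInt f u t) ->
  (is_RInt_gen f F (at_point t) l <-> filterlim (fun u => RInt f u t) F (locally l)).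
Proof.
  intros Hex. split.
  - intros H P HP. destruct (H P HP) as [Q R HQ HR HQR]. unfold filtermap.
    revert HQ. apply filter_imp. intros u Hu.
    destruct (HQR u t Hu HR) as (y & Hy & HPy). simpl in Hy.
    rewrite (is_RInt_unique _ _ _ _ Hy). exact HPy.
  - intros H P HP.
    apply Filter_prod with (fun u => ex_RInt f u t /\ P (RInt f u t)) (fun x => x = t).
    + apply filter_and; [exact Hex | exact (H P HP)].
    + reflexivity.
    + intros u x [Hu HPu] ->. exists (RInt f u t). split; [| exact HPu].
      apply (RInt_correct f), Hu.
Qed.

(** The integrands of the statement are controlled on [I] alone. This exchanges them for functions
    continuous on the hull and supplies integrability at the same time. *)
Lemma RInt_agree (I Io J : R -> Prop) (f g : R -> R) (u t : R) :
  interval_hull I Io J -> continuous_in J g -> (forall x, I x -> f x = g x) -> I u -> I t ->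
  ex_RInt f u t /\ RInt f u t = RInt g u t.
Proof.
  intros [HO HJ HI HIJ HIo Hb] Hg Hfg Hu Ht.
  assert (E : forall x, Rmin u t < x < Rmax u t -> f x = g x).
  { intros x Hx. apply Hfg, (HI u t); auto. lra. }
  split; [| apply RInt_ext_R, E].
  apply (ex_RInt_ext (V := R_NormedModule) g); [intros x Hx; symmetry; apply E, Hx |].
  apply (ex_RInt_in J); auto.
Qed.

Lemma is_RInt_gen_to_right (I Io J : R -> Prop) (F : (R -> Prop) -> Prop) {FF : Filter F}
  (f g : R -> R) (t l : R) :
  interval_hull I Io J -> F Io -> continuous_in J g -> (forall x, I x -> f x = g x) -> I t ->
  (is_RInt_gen f (at_point t) F l <-> lim_int F (-1) g t l).
Proof.
  intros HH HF Hg Hfg Ht. pose proof HH as [HO HJ HI HIJ HIo Hb].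
  assert (E : F (fun u => -1 * RInt g u t = RInt f t u)).
  { revert HF. apply filter_imp. intros u Hu.
    destruct (RInt_agree I Io J f g t u HH Hg Hfg Ht (HIo u Hu)) as [_ ->].
    rewrite (RInt_swap_in J g u t) by auto. ring. }
  rewrite (is_RInt_gen_at_point_l f F t l).
  - unfold lim_int. split; apply filterlim_ext_loc; try exact E.
    revert E. apply filter_imp. intros u Hu. symmetry. exact Hu.
  - revert HF. apply filter_imp. intros u Hu.
    apply (RInt_agree I Io J f g t u HH Hg Hfg Ht (HIo u Hu)).
Qed.

Lemma is_RInt_gen_from_left (I Io J : R -> Prop) (F : (R -> Prop) -> Prop) {FF : Filter F}
  (f g : R -> R) (t l : R) :
  interval_hull I Io J -> F Io -> continuous_in J g -> (forall x, I x -> f x = g x) -> I t ->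
  (is_RInt_gen f F (at_point t) l <-> lim_int F 1 g t l).
Proof.
  intros HH HF Hg Hfg Ht. pose proof HH as [HO HJ HI HIJ HIo Hb].
  assert (E : F (fun u => 1 * RInt g u t = RInt f u t)).
  { revert HF. apply filter_imp. intros u Hu.
    destruct (RInt_agree I Io J f g u t HH Hg Hfg (HIo u Hu) Ht) as [_ ->]. ring. }
  rewrite (is_RInt_gen_at_point_r f F t l).
  - unfold lim_int. split; apply filterlim_ext_loc; try exact E.
    revert E. apply filter_imp. intros u Hu. symmetry. exact Hu.
  - revert HF. apply filter_imp. intros u Hu.
    apply (RInt_agree I Io J f g u t HH Hg Hfg (HIo u Hu) Ht).
Qed.

(** * Ulam stability *)

(** The algebraic half of the argument: bounded solutions of the first-order system give the Ulam
    constant. The map [c] is a retraction of [J] onto [I], by which the residual and the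
    coefficients are extended. *)
Lemma ulam_constant_of_factorization (I J : R -> Prop) (c : R -> R)
  {n : nat} (N : vec n -> R)
  (alpha beta gamma : R -> C) (f : R -> vec n) (rho rho' : R -> C) (L : R) :
  (forall t, I t -> J t) -> (forall t, I t -> c t = t) -> (forall t, J t -> I (c t)) ->
  (forall g, ccont_on I g -> Ccontinuous_in J (fun t => g (c t))) ->
  ccont_on I alpha -> ccont_on I beta -> ccont_on I gamma ->
  (forall t, I t -> alpha t <> RtoC 0) ->
  (forall i, ccont_on I (fun t => f t i)) ->
  cderiv_on I rho rho' -> ccont_on I rho' ->
  (forall t, I t ->
     Cplus (Cplus (Cmult (alpha t) (Cplus (rho' t) (Cmult (rho t) (rho t))))
                  (Cmult (beta t) (rho t)))
           (gamma t) = RtoC 0) ->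
  0 < L ->
  (forall (eps : R) (p : R -> vec n), 0 < eps ->
      (forall i, Ccontinuous_in J (fun s => p s i)) -> (forall s, I s -> N (p s) <= eps) ->
      exists z w : R -> vec n,
        (forall t i, J t -> Cderive (fun s => z s i) t (Cplus (Cmult (rho (c t)) (z t i)) (w t i))) /\
        (forall t i, J t -> Cderive (fun s => w s i) t
           (Cminus (Cdiv (p t i) (alpha (c t)))
              (Cmult (Cplus (rho (c t)) (Cdiv (beta (c t)) (alpha (c t)))) (w t i)))) /\
        (forall t, I t -> N (z t) <= L * eps)) ->
  ulam_constant I N alpha beta gamma f L.
Proof.
  intros HIJ Hc HcI Hext Ha Hb Hg Hanz Hf Hrho Hrho' Hric HL Hstage.
  pose proof (cderiv_on_ccont_on I _ _ Hrho) as Hrhoc.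
  split; [exact HL |]. intros eps He xi xi1 xi2 Hxi Hres.
  set (p := fun t i => Cminus (Cplus (Cplus (Cmult (alpha t) (xi2 t i)) (Cmult (beta t) (xi1 t i)))
                               (Cmult (gamma t) (xi t i))) (f t i) : C).
  assert (Hpc : forall i, ccont_on I (fun t => p t i)).
  { intros i t Ht. destruct (Hxi i) as (D1 & D2 & D3).
    apply filterlim_Cminus; [typeclasses eauto | | apply Hf, Ht].
    repeat apply filterlim_Cplus; try typeclasses eauto;
      apply filterlim_Cmult; try typeclasses eauto; auto.
    - apply (cderiv_on_ccont_on I _ _ D2 t Ht).
    - apply (cderiv_on_ccont_on I _ _ D1 t Ht). }
  destruct (Hstage eps (fun t => p (c t)) He (fun i => Hext _ (Hpc i))) as (z & w & Hz & Hw & Hb').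
  { intros s Hs. rewrite (Hc s Hs). apply Hres, Hs. }
  (* [w1] and [z1] are the right-hand sides of the two equations, and [z2] is the derivative of [z1]
     by the product rule; this is where [rho] must be of class C^1 for [z] to be of class C^2. *)
  set (w1 := fun t i => Cminus (Cdiv (p t i) (alpha t))
              (Cmult (Cplus (rho t) (Cdiv (beta t) (alpha t))) (w t i)) : C).
  set (z1 := fun t i => Cplus (Cmult (rho t) (z t i)) (w t i) : C).
  set (z2 := fun t i => Cplus (Cplus (Cmult (rho' t) (z t i)) (Cmult (rho t) (z1 t i))) (w1 t i) : C).
  assert (Dz : forall i, cderiv_on I (fun t => z t i) (fun t => z1 t i)).
  { intros i. apply cderiv_on_Cderive. intros t Ht. unfold z1.
    generalize (Hz t i (HIJ t Ht)). rewrite (Hc t Ht). trivial. }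
  assert (Dw : forall i, cderiv_on I (fun t => w t i) (fun t => w1 t i)).
  { intros i. apply cderiv_on_Cderive. intros t Ht. unfold w1.
    generalize (Hw t i (HIJ t Ht)). rewrite (Hc t Ht). trivial. }
  assert (Dz1 : forall i, cderiv_on I (fun t => z1 t i) (fun t => z2 t i)).
  { intros i. apply cderiv_on_plus; [| apply Dw].
    apply cderiv_on_mult; [| exact Hrho | apply Dz]. apply (cderiv_on_ccont_on I _ _ (Dz i)). }
  assert (Cz2 : forall i, ccont_on I (fun t => z2 t i)).
  { intros i t Ht.
    apply filterlim_Cplus; [typeclasses eauto | apply filterlim_Cplus; [typeclasses eauto | |] |].
    - apply filterlim_Cmult; [typeclasses eauto | auto | apply (cderiv_on_ccont_on I _ _ (Dz i) t Ht)].
    - apply filterlim_Cmult; [typeclasses eauto | auto | apply (cderiv_on_ccont_on I _ _ (Dz1 i) t Ht)].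
    - apply filterlim_Cminus; [typeclasses eauto | |].
      + apply filterlim_Cdiv; try typeclasses eauto; auto. apply Hpc, Ht.
      + apply filterlim_Cmult; [typeclasses eauto | | apply (cderiv_on_ccont_on I _ _ (Dw i) t Ht)].
        apply filterlim_Cplus; [typeclasses eauto | auto |].
        apply filterlim_Cdiv; try typeclasses eauto; auto. }
  exists (fun t i => Cminus (xi t i) (z t i)), (fun t i => Cminus (xi1 t i) (z1 t i)),
    (fun t i => Cminus (xi2 t i) (z2 t i)).
  split; [| split].
  - intros i. destruct (Hxi i) as (D1 & D2 & D3). split; [| split].
    + apply cderiv_on_minus; auto.
    + apply cderiv_on_minus; auto.
    + intros t Ht. apply filterlim_Cminus; [typeclasses eauto | auto | apply Cz2, Ht].
  - intros t Ht i. specialize (Hric t Ht). specialize (Hanz t Ht).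
    (* In [alpha z2 + beta z1 + gamma z] the terms in [w] cancel, leaving [p] plus [z] times the
       Riccati expression. *)
    transitivity (Cminus (f t i) (Cmult (z t i)
      (Cplus (Cplus (Cmult (alpha t) (Cplus (rho' t) (Cmult (rho t) (rho t))))
                  (Cmult (beta t) (rho t)))
           (gamma t)))).
    + unfold z2, z1, w1, p. field. exact Hanz.
    + rewrite Hric. ring.
  - intros t Ht.
    replace (fun i => Cminus (xi t i) (Cminus (xi t i) (z t i))) with (z t);
      [apply Hb', Ht |].
    extensionality i. ring.
Qed.

(** An exponent depending on two bounds becomes a difference of values of one primitive, so the
    kernels factor into a function of [t] times a function of the integration variable. *)
Lemma RInt_primitive_difference (I Io J : R -> Prop) (f : R -> R) (q : R -> C) (t0 u t : R) :
  interval_hull I Io J -> Ccontinuous_in J q -> (forall x, I x -> f x = Re (q x)) ->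
  I t0 -> I u -> I t ->
  RInt f u t = Re (CRInt q t0 t) - Re (CRInt q t0 u).
Proof.
  intros HH Hq Hf H0 Hu Ht. destruct (Ccontinuous_in_components J q Hq) as [Hre _].
  destruct (RInt_agree I Io J f _ u t HH Hre Hf Hu Ht) as [_ ->].
  destruct HH as [HO HJ HI HIJ HIo Hb]. simpl.
  rewrite (RInt_Chasles_in J _ t0 u t) by auto. symmetry. apply Rplus_minus_l.
Qed.

Theorem theorem3p1
  (tau sigma : Rbar) (btau bsigma : bool)
  (Hts : Rbar_lt tau sigma)
  (Hbt : btau = true -> is_finite tau)
  (Hbs : bsigma = true -> is_finite sigma)
  (n : nat) (N : vec n -> R) (HN : is_norm N)
  (alpha beta gamma : R -> C) (f : R -> vec n)
  (Halpha : ccont_on (Iset tau sigma btau bsigma) alpha)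
  (Hbeta : ccont_on (Iset tau sigma btau bsigma) beta)
  (Hgamma : ccont_on (Iset tau sigma btau bsigma) gamma)
  (Hanz : forall t, Iset tau sigma btau bsigma t -> alpha t <> RtoC 0)
  (Hf : forall i : Fin.t n, ccont_on (Iset tau sigma btau bsigma) (fun t => f t i))
  (rho rho' : R -> C)
  (Hrho : cderiv_on (Iset tau sigma btau bsigma) rho rho')
  (Hrho' : ccont_on (Iset tau sigma btau bsigma) rho')
  (Hric : forall t, Iset tau sigma btau bsigma t ->
     Cplus (Cplus (Cmult (alpha t) (Cplus (rho' t) (Cmult (rho t) (rho t))))
                  (Cmult (beta t) (rho t)))
           (gamma t) = RtoC 0) :
  let I := Iset tau sigma btau bsigma in
  (* (i) *)
  ((exists F1 : R -> R,
      (forall t, I t -> is_RInt_gen (g1 rho alpha beta t) (at_point t) (to_sigma sigma) (F1 t))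
      /\ exists M, forall t, I t -> F1 t <= M) ->
   (exists F2 : R -> R,
      (forall t, I t -> is_RInt_gen (g2 rho t) (at_point t) (to_sigma sigma) (F2 t))
      /\ exists M, forall t, I t -> F2 t <= M) ->
   exists (G H : R -> R) (L1 : R),
     (forall s, I s -> is_RInt_gen (g1 rho alpha beta s) (at_point s) (to_sigma sigma) (G s)) /\
     (forall t, I t -> is_RInt_gen (fun s => G s * exp (- RInt (reR rho) t s))
                          (at_point t) (to_sigma sigma) (H t)) /\
     is_lub (fun y => exists t, I t /\ y = H t) L1 /\
     ulam_constant I N alpha beta gamma f L1)
  /\
  (* (ii) *)
  ((exists F1 : R -> R,
      (forall t, I t -> is_RInt_gen (g1 rho alpha beta t) (at_point t) (to_sigma sigma) (F1 t))
      /\ exists M, forall t, I t -> F1 t <= M) ->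
   (exists F3 : R -> R,
      (forall t, I t -> is_RInt_gen (g3 rho t) (to_tau tau) (at_point t) (F3 t))
      /\ exists M, forall t, I t -> F3 t <= M) ->
   exists (G H : R -> R) (L2 : R),
     (forall s, I s -> is_RInt_gen (g1 rho alpha beta s) (at_point s) (to_sigma sigma) (G s)) /\
     (forall t, I t -> is_RInt_gen (fun s => G s * exp (RInt (reR rho) s t))
                          (to_tau tau) (at_point t) (H t)) /\
     is_lub (fun y => exists t, I t /\ y = H t) L2 /\
     ulam_constant I N alpha beta gamma f L2)
  /\
  (* (iii) *)
  ((exists F3 : R -> R,
      (forall t, I t -> is_RInt_gen (g3 rho t) (to_tau tau) (at_point t) (F3 t))
      /\ exists M, forall t, I t -> F3 t <= M) ->
   (exists F4 : R -> R,
      (forall t, I t -> is_RInt_gen (g4 rho alpha beta t) (to_tau tau) (at_point t) (F4 t))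
      /\ exists M, forall t, I t -> F4 t <= M) ->
   exists (G H : R -> R) (L3 : R),
     (forall s, I s -> is_RInt_gen (g4 rho alpha beta s) (to_tau tau) (at_point s) (G s)) /\
     (forall t, I t -> is_RInt_gen (fun s => G s * exp (RInt (reR rho) s t))
                          (to_tau tau) (at_point t) (H t)) /\
     is_lub (fun y => exists t, I t /\ y = H t) L3 /\
     ulam_constant I N alpha beta gamma f L3).
Proof.
  intros I.
  pose proof (Iset_hull tau sigma btau bsigma) as HH. fold I in HH.
  set (Io := Iinterior tau sigma) in HH.
  set (J := Ihull tau sigma btau bsigma) in HH.
  set (c := clamp tau sigma btau bsigma).
  pose proof HH as [HO HJ HI HIJ HIo Hbtw].
  assert (Hc : forall t, I t -> c t = t) by (intros t Ht; apply clamp_id; assumption).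
  assert (HcI : forall t, J t -> I (c t)) by (intros t Ht; apply clamp_in; assumption).
  assert (Hext : forall g, ccont_on I g -> Ccontinuous_in J (fun t => g (c t)))
    by (intros g Hg; apply clamp_extension; assumption).
  (* [t0] is the base point of the primitives [Q] and [P]; being interior, it is also a point where
     the double integral is positive. *)
  destruct (Iinterior_inhabited tau sigma Hts) as [t0 H0]. fold Io in H0.
  pose proof (cderiv_on_ccont_on I rho rho' Hrho) as Hrhoc.
  assert (Hanzc : forall t, J t -> alpha (c t) <> RtoC 0) by (intros t Ht; apply Hanz, HcI, Ht).
  set (q := fun x => Cplus (rho (c x)) (Cdiv (beta (c x)) (alpha (c x)))).
  set (r := fun x => rho (c x)).
  assert (Hr : Ccontinuous_in J r) by (apply Hext, Hrhoc).
  assert (Ha : Ccontinuous_in J (fun x => alpha (c x))) by (apply Hext, Halpha).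
  assert (Hq : Ccontinuous_in J q).
  { intros t Ht. apply (filterlim_Cplus (locally t)); [apply Hr, Ht |].
    apply (filterlim_Cdiv (locally t));
      [apply Hanzc, Ht | apply (Hext beta Hbeta), Ht | apply Ha, Ht]. }
  set (Q := CRInt q t0). set (P := CRInt r t0).
  assert (HQ : forall t, J t -> Cderive Q t (q t))
    by (intros t Ht; apply (Cderive_primitive J); auto).
  assert (HP : forall t, J t -> Cderive P t (r t))
    by (intros t Ht; apply (Cderive_primitive J); auto).
  assert (DQ : forall u t, I u -> I t -> RInt (reRBA rho alpha beta) u t = Re (Q t) - Re (Q u)).
  { intros u t Hu Ht. apply (RInt_primitive_difference I Io J); auto.
    intros x Hx. unfold q. rewrite (Hc x Hx). reflexivity. }
  assert (DP : forall u t, I u -> I t -> RInt (reR rho) u t = Re (P t) - Re (P u)).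
  { intros u t Hu Ht. apply (RInt_primitive_difference I Io J); auto.
    intros x Hx. unfold r. rewrite (Hc x Hx). reflexivity. }
  (* [k1] covers both [g1] and [g4], and [k2] both [g2] and [g3]: within each pair, exchanging the
     bounds of the inner integral compensates the change of sign in the exponent. *)
  set (k1 := fun t x => exp (Re (Q x) - Re (Q t)) / Cmod (alpha (c x))).
  set (k2 := fun t x => exp (Re (P t) - Re (P x))).
  assert (Hk1 : forall t, continuous_in J (k1 t)).
  { intros t x Hx. apply (filterlim_R_mult (locally x)).
    - apply (filterlim_R_exp (locally x)), (filterlim_R_minus (locally x)); [| apply filterlim_const].
      apply (filterlim_C (locally x) Q), (Cderive_continuous Q x _ (HQ x Hx)).
    - apply (filterlim_R_inv (locally x)).
      + apply Rgt_not_eq, Cmod_gt_0, Hanzc, Hx.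
      + apply (filterlim_Cmod (locally x)), Ha, Hx. }
  assert (Hk2 : forall t, continuous_in J (k2 t)).
  { intros t x Hx.
    apply (filterlim_R_exp (locally x)), (filterlim_R_minus (locally x)); [apply filterlim_const |].
    apply (filterlim_C (locally x) P), (Cderive_continuous P x _ (HP x Hx)). }
  assert (Eg1 : forall t, I t -> forall x, I x -> g1 rho alpha beta t x = k1 t x).
  { intros t Ht x Hx. unfold g1, k1. rewrite (DQ t x Ht Hx), (Hc x Hx). reflexivity. }
  assert (Eg4 : forall t, I t -> forall x, I x -> g4 rho alpha beta t x = k1 t x).
  { intros t Ht x Hx. unfold g4, k1. rewrite (DQ x t Hx Ht), (Hc x Hx). do 2 f_equal. ring. }
  assert (Eg2 : forall t, I t -> forall x, I x -> g2 rho t x = k2 t x).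
  { intros t Ht x Hx. unfold g2, k2. rewrite (DP t x Ht Hx). f_equal. ring. }
  assert (Eg3 : forall t, I t -> forall x, I x -> g3 rho t x = k2 t x).
  { intros t Ht x Hx. unfold g3, k2. rewrite (DP x t Hx Ht). reflexivity. }
  assert (Stage : forall (F1 F2 : (R -> Prop) -> Prop) (s1 s2 : R) (Gam1 Gam2 : R -> R) (M1 M2 : R),
    endpoint_filter I Io F1 s1 -> endpoint_filter I Io F2 s2 ->
    (forall t, I t -> lim_int F1 s1 (k1 t) t (Gam1 t)) -> (forall t, I t -> Gam1 t <= M1) ->
    (forall t, I t -> lim_int F2 s2 (k2 t) t (Gam2 t)) -> (forall t, I t -> Gam2 t <= M2) ->
    exists (G H : R -> R) (L : R),
      (forall t, continuous_in J (fun x => G x * k2 t x)) /\ (forall t, I t -> G t = Gam1 t) /\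
      (forall t, I t -> lim_int F2 s2 (fun x => G x * k2 t x) t (H t)) /\
      is_lub (fun y => exists t, I t /\ y = H t) L /\
      ulam_constant I N alpha beta gamma f L).
  { intros F1 F2 s1 s2 Gam1 Gam2 M1 M2 E1 E2 HG1 HM1 HG2 HM2.
    destruct (two_stage_bound I Io J t0 F1 F2 s1 s2 N HN (fun x => alpha (c x)) q Q r P
                Gam1 Gam2 M1 M2) as (G & H & L & A1 & A2 & A3 & A4 & A5 & A6); auto.
    exists G, H, L. split; [| split; [| split; [| split]]]; auto.
    - intros t x Hx. apply (filterlim_R_mult (locally x)); [apply A1, Hx | apply Hk2, Hx].
    - apply (ulam_constant_of_factorization I J c N alpha beta gamma f rho rho' L); auto. }
  pose proof (to_sigma_endpoint tau sigma btau bsigma Hts) as Es.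
  pose proof (to_tau_endpoint tau sigma btau bsigma Hts) as Et.
  fold I Io in Es, Et.
  pose proof Es as [FFs _ HFs _ _]. pose proof Et as [FFt _ HFt _ _].
  split; [| split].
  - intros (F1 & H1 & M1 & B1) (F2 & H2 & M2 & B2).
    destruct (Stage (to_sigma sigma) (to_sigma sigma) (-1) (-1) F1 F2 M1 M2)
      as (G & H & L & CG & EG & HH' & HL & HU); auto.
    { intros t Ht. apply (is_RInt_gen_to_right I Io J _ (g1 rho alpha beta t)); auto. }
    { intros t Ht. apply (is_RInt_gen_to_right I Io J _ (g2 rho t)); auto. }
    exists G, H, L. split; [| split; [| split]]; auto.
    (* [G] is the continuous extension to the hull, equal on [I] to the integral given by the
       hypothesis. *)
    + intros s Hs. rewrite (EG s Hs). apply H1, Hs.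
    + intros t Ht. apply (is_RInt_gen_to_right I Io J _ _ (fun x => G x * k2 t x)); auto.
      intros x Hx. rewrite <- (Eg2 t Ht x Hx). reflexivity.
  - intros (F1 & H1 & M1 & B1) (F3 & H3 & M3 & B3).
    destruct (Stage (to_sigma sigma) (to_tau tau) (-1) 1 F1 F3 M1 M3)
      as (G & H & L & CG & EG & HH' & HL & HU); auto.
    { intros t Ht. apply (is_RInt_gen_to_right I Io J _ (g1 rho alpha beta t)); auto. }
    { intros t Ht. apply (is_RInt_gen_from_left I Io J _ (g3 rho t)); auto. }
    exists G, H, L. split; [| split; [| split]]; auto.
    + intros s Hs. rewrite (EG s Hs). apply H1, Hs.
    + intros t Ht. apply (is_RInt_gen_from_left I Io J _ _ (fun x => G x * k2 t x)); auto.
      intros x Hx. rewrite <- (Eg3 t Ht x Hx). reflexivity.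
  - intros (F3 & H3 & M3 & B3) (F4 & H4 & M4 & B4).
    (* The inner integral belongs to the equation for [w], whose kernel is [g4]; the two hypotheses
       therefore enter in reverse order. *)
    destruct (Stage (to_tau tau) (to_tau tau) 1 1 F4 F3 M4 M3)
      as (G & H & L & CG & EG & HH' & HL & HU); auto.
    { intros t Ht. apply (is_RInt_gen_from_left I Io J _ (g4 rho alpha beta t)); auto. }
    { intros t Ht. apply (is_RInt_gen_from_left I Io J _ (g3 rho t)); auto. }
    exists G, H, L. split; [| split; [| split]]; auto.
    + intros s Hs. rewrite (EG s Hs). apply H4, Hs.
    + intros t Ht. apply (is_RInt_gen_from_left I Io J _ _ (fun x => G x * k2 t x)); auto.
      intros x Hx. rewrite <- (Eg3 t Ht x Hx). reflexivity.
Qed.
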